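(* Let $\mathcal A$ be a maximal Banach operator ideal such that for every finite-dimensional Banach space $M$ and every Banach space $F$, every Lipschitz function $f\in\mathcal A\circ\mathrm{Lip}_0(M,F)$ has a point of Gateaux differentiability in $M$. Then $$(\mathrm{Lip}_0\circ\mathcal A\circ\mathrm{Lip}_0)\cap\mathcal L=(\mathrm{Lip}_0\circ\mathcal A\circ\mathrm{Lip}_0)^{\max}\cap\mathcal L=\mathcal A .$$
   Context: Banach spaces are real; $\mathcal L(E,F)$ is the space of bounded linear operators. A Banach operator ideal $\mathcal A$ is a Banach ideal of bounded linear operators in the sense of Pietsch, with norm $\|\cdot\|_{\mathcal A}$. Its maximal hull $\mathcal A^{\max}$ consists of those $T\in\mathcal L(E,F)$ with $\|T\|_{\mathcal A^{\max}}:=\sup\|q_L^F\circ T\circ\iota_M^E\|_{\mathcal A}<\infty$, over all finite-dimensional subspaces $M\subset E$ (inclusion $\iota_M^E\colon M\to E$) and closed finite-codimensional subspaces $L\subset F$ (quotient map $q_L^F\colon F\to F/L$); $\mathcal A$ is maximal if $\mathcal A=\mathcal A^{\max}$. A pointed metric space has a distinguished point $0$ (for a Banach space, its origin). $\mathrm{Lip}_0(X,Y)$ is the set of Lipschitz maps $f\colon X\to Y$ with $f(0)=0$, and $\mathrm{Lip}(f)$ is the least Lipschitz constant. For a pointed metric space $X$ and Banach space $E$: $\mathcal A\circ\mathrm{Lip}_0(X,E)$ is the set of $f=S\circ g$ with $G$ a Banach space, $g\in\mathrm{Lip}_0(X,G)$, $S\in\mathcal A(G,E)$; $\mathrm{Lip}_0\circ\mathcal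 A\circ\mathrm{Lip}_0(X,E)$ is the set of $f=g_2\circ T\circ g_1$ with $G_1,G_2$ Banach spaces, $g_1\in\mathrm{Lip}_0(X,G_1)$, $T\in\mathcal A(G_1,G_2)$, $g_2\in\mathrm{Lip}_0(G_2,E)$, with norm $\inf\mathrm{Lip}(g_1)\|T\|_{\mathcal A}\mathrm{Lip}(g_2)$ over all such factorizations. For $\mathcal I=\mathrm{Lip}_0\circ\mathcal A\circ\mathrm{Lip}_0$, the maximal hull $\mathcal I^{\max}(X,E)$ is the set of $f\in\mathrm{Lip}_0(X,E)$ with $\|f\|_{\mathcal I^{\max}}:=\sup\|q_L^E\circ f\circ\iota_{X_0}^X\|_{\mathcal I}<\infty$, over all finite subsets $X_0\subset X$ containing $0$ and closed finite-codimensional subspaces $L\subset E$. For $\mathcal J\in\{\mathcal I,\mathcal I^{\max}\}$, $\mathcal J\cap\mathcal L$ has components $\mathcal J(E,F)\cap\mathcal L(E,F)$ ($E,F$ Banach spaces) with the norm $\|\cdot\|_{\mathcal J}$. Equality of ideals means equal components with equal norms. A map $f\colon M\to F$ between Banach spaces is Gateaux differentiable at $x_0$ if there is $Df(x_0)\in\mathcal L(M,F)$ with $Df(x_0)(x)=\lim_{t\to0}\frac{f(x_0+tx)-f(x_0)}{t}$ for every $x\in M$. *)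

(* Defs.v *)
From HB Require Import structures.
From mathcomp Require Import all_boot all_order all_algebra.
From mathcomp Require Import generic_quotient ring_quotient.
From mathcomp Require Import all_classical all_reals all_analysis.

Set Implicit Arguments.
Unset Strict Implicit.
Unset Printing Implicit Defensive.

Import Order.TTheory GRing.Theory Num.Theory.
Import numFieldNormedType.Exports.

Local Open Scope classical_set_scope.
Local Open Scope ring_scope.

Definition finite_dim (R : realType) (V : lmodType R) : Prop :=
  exists (n : nat) (e : 'I_n -> V),
    forall x : V, exists a : 'I_n -> R, x = \sum_(i < n) a i *: e i.

Section FiniteDimComplete.
Context {R : realType} (V : normedModType R).

Section Coordinates.
Context (n : nat) (e : 'I_n -> V).

Let phi (w : 'rV[R]_n) : V := \sum_(i < n) w ord0 i *: e i.

Let phi_linear : linear phi.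
Proof.
move=> a x y; rewrite /phi scaler_sumr -big_split /=; apply: eq_bigr => i _.
by rewrite !mxE scalerDl scalerA.
Qed.

Let phi0 : phi 0 = 0.
Proof. by rewrite /phi big1 // => i _; rewrite mxE scale0r. Qed.

Let phiZ a x : phi (a *: x) = a *: phi x.
Proof. by rewrite -[a *: x]addr0 phi_linear phi0 addr0. Qed.

Let phiB x y : phi (x - y) = phi x - phi y.
Proof. by rewrite addrC -scaleN1r phi_linear scaleN1r addrC. Qed.

Let phi_cont : continuous phi.
Proof.
apply: continuous_big => [|i _ w]; first exact: add_continuous.
exact: (@cvgZr_tmp _ _ _ (nbhs w) _ _ _ (e i) (@coord_continuous R 1 n ord0 i w)).
Qed.

Let spanning := forall x, exists w, x = phi w.

Let free := forall w, phi w = 0 -> w = 0.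

Lemma coord_lower_bound : free ->
  exists2 c : R, 0 < c & forall w, c * `|w| <= `|phi w|.
Proof.
move=> fr.
pose S : set 'rV[R]_n := [set w | `|w| = 1].
have cS : compact S.
  apply: bounded_closed_compact.
    exists 1; split; first exact: num_real.
    by move=> x x1 y /= ->; exact: ltW.
  rewrite (_ : S = (fun w : 'rV[R]_n => `|w|) @^-1` [set 1]) //.
  apply: closed_comp; last exact: closed_eq.
  by move=> x _; exact: norm_continuous.
pose h (w : 'rV[R]_n) : R := `|phi w|.
have ch : continuous h.
  by move=> w; exact: continuous_comp (@phi_cont w) (@norm_continuous _ _ _).
have cK : closed (h @` S).
  apply: compact_closed; first exact: Rhausdorff.
  apply: continuous_compact => //.
  exact: continuous_subspaceT.
have : (~` (h @` S)) (0 : R).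
  move=> [w Sw /normr0_eq0 /fr w0].
  by move: Sw; rewrite /S /= w0 normr0 => /esym/eqP; rewrite oner_eq0.
move=> K0.
have /nbhs_ballP [c /= c0 cB] : nbhs (0 : R) (~` (h @` S)).
  by apply: open_nbhs_nbhs; split => //; exact: closed_openC.
exists c => // w.
have [->|w0] := eqVneq w 0; first by rewrite normr0 mulr0.
have nw : 0 < `|w| by rewrite normr_gt0.
rewrite -ler_pdivlMr // leNgt; apply/negP => hlt.
apply: (cB (h (`|w|^-1 *: w))); last first.
  exists (`|w|^-1 *: w) => //; rewrite /S /= normrZ normfV normr_id mulVf //.
  by rewrite gt_eqF.
rewrite /ball /= sub0r normrN /h normr_id phiZ normrZ normfV normr_id.
by rewrite mulrC.
Qed.

Lemma coord_complete : spanning -> free ->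
  forall F : set_system V, ProperFilter F -> cauchy F -> cvg F.
Proof.
move=> sp /coord_lower_bound [c c0 cle] F FF /cauchy_ballP Fc.
pose psi x := projT1 (cid (sp x)).
have psiK x : phi (psi x) = x by rewrite /psi; case: cid => w /= <-.
have : cauchy (psi @ F).
  apply/cauchy_ballP => r r0.
  have cr : 0 < c * r by rewrite mulr_gt0.
  have := Fc _ cr.
  rewrite !near_simpl => -[[P Q]] /= [FP FQ] PQ.
  exists (psi @` P, psi @` Q).
    by split; [apply: filterS FP|apply: filterS FQ] => x Px; exists x.
  move=> -[_ _] [/= [x Px <-] [y Qy <-]] /=.
  have := PQ (x, y) (conj Px Qy).
  rewrite -!ball_normE /= => xy.
  rewrite -(ltr_pM2l c0); apply: le_lt_trans xy.
  by rewrite (le_trans (cle _)) // phiB !psiK.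
move/cauchy_cvg => /cvg_ex [w Fw].
apply/cvg_ex; exists (phi w).
rewrite (_ : F = (phi \o psi) @ F); last first.
  by rewrite (_ : phi \o psi = id) //; apply/funext => x /=.
by apply: cvg_comp Fw _; exact: phi_cont.
Qed.

End Coordinates.

Lemma finite_dim_complete : finite_dim V ->
  forall F : set_system V, ProperFilter F -> cauchy F -> cvg F.
Proof.
move=> Vfin.
pose spans n := exists e : 'I_n -> V,
  forall x : V, exists a : 'I_n -> R, x = \sum_(i < n) a i *: e i.
have ex : exists n, `[< spans n >].
  by case: Vfin => n sn; exists n; apply/asboolP.
have [n /asboolP [e sp] nmin] := ex_minnP ex.
apply: (@coord_complete n e).
  move=> x; have [a ->] := sp x; exists (\row_i a i).
  by apply: eq_bigr => i _; rewrite mxE.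
move=> w w0; apply/rowP => k; rewrite mxE; apply/eqP; apply: contraT => wk.
case: n => [|n] in ex e sp nmin w w0 k wk *; first by case: k wk.
suff : spans n by move=> /asboolP /nmin; rewrite ltnn.
exists (fun i => e (lift k i)) => x.
have [a ->] := sp x.
exists (fun i => a (lift k i) - a k / w ord0 k * w ord0 (lift k i)).
have split_k (b : 'I_n.+1 -> R) : \sum_(i < n.+1) b i *: e i =
    b k *: e k + \sum_(i < n) b (lift k i) *: e (lift k i).
  rewrite (bigD1 k) //=; congr (_ + _).
  rewrite (reindex_omap (lift k) (unlift k)) /=.
    apply: eq_bigl => i; by rewrite liftK eqxx eq_sym neq_lift.
  by move=> i; rewrite eq_sym => /unlift_some[j -> ->].
move: w0; rewrite (split_k (w ord0)) => /eqP; rewrite addr_eq0 => /eqP w0.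
rewrite split_k.
have -> : e k = - (w ord0 k)^-1 *: \sum_(i < n) w ord0 (lift k i) *: e (lift k i).
  by rewrite scaleNr -scalerN -w0 scalerA mulVf // scale1r.
rewrite scaler_sumr scaler_sumr -big_split /=; apply: eq_bigr => i _.
by rewrite !scalerA -scalerDl addrC mulrN mulNr.
Qed.

End FiniteDimComplete.

Definition finite_dim_banach (R : realType) (V : normedModType R)
    (fV : finite_dim V) : completeNormedModType R :=
  HB.pack V (Uniform_isComplete.Build V (finite_dim_complete fV)).

Record subspace (R : realType) (E : normedModType R) := Subspace {
  subspace_set : set E;
  subspace0 : subspace_set 0;
  subspaceP : forall (a : R) x y, subspace_set x -> subspace_set y ->
    subspace_set (a *: x + y)
}.

Section SubspacePred.
Context {R : realType} {E : normedModType R} (M : subspace E).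

Definition subspace_pred : {pred E} := fun x => `[< subspace_set M x >].

Let subspace_pred_closed : GRing.submod_closed subspace_pred.
Proof.
split; first by apply/asboolP; exact: subspace0.
by move=> a x y /asboolP Mx /asboolP My; apply/asboolP; exact: subspaceP.
Qed.

HB.instance Definition _ :=
  GRing.isSubmodClosed.Build R E subspace_pred subspace_pred_closed.

Definition subspace_type : Type := {x : E | subspace_pred x}.

HB.instance Definition _ := SubChoice.on subspace_type.
HB.instance Definition _ :=
  [SubChoice_isSubLmodule of subspace_type by <:].

Definition subspace_incl (x : subspace_type) : E := val x.

Let sub_norm (x : subspace_type) : R := `|subspace_incl x|.

Let sub_ler_normD x y : sub_norm (x + y) <= sub_norm x + sub_norm y.
Proof. exact: ler_normD. Qed.

Let sub_normrZ (l : R) x : sub_norm (l *: x) = `|l| * sub_norm x.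
Proof. exact: normrZ. Qed.

Let sub_normr0_eq0 x : sub_norm x = 0 -> x = 0.
Proof. by move=> /normr0_eq0 x0; apply/val_inj. Qed.

HB.instance Definition _ := Lmodule_isNormed.Build R subspace_type
  sub_ler_normD sub_normrZ sub_normr0_eq0.

End SubspacePred.

Record closed_subspace (R : realType) (F : normedModType R) := ClosedSubspace {
  closed_subspace_val :> subspace F;
  closed_subspaceP : closed (subspace_set closed_subspace_val)
}.

Section Quotient.
Context {R : realType} {F : normedModType R} (L : closed_subspace F).

Local Notation quot := (Quotient.quot (subspace_pred L)).

Definition quot_type : Type := quot.

HB.instance Definition _ := Choice.on quot_type.
HB.instance Definition _ := GRing.Zmodule.on quot_type.

Definition quot_map (x : F) : quot_type := (\pi_quot x)%qT.

Lemma quot_map_surj (u : quot_type) : exists x, quot_map x = u.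
Proof. by exists (repr (u : quot)); rewrite /quot_map reprK. Qed.

Lemma quot_mapE (x y : F) :
  quot_map x = quot_map y <-> subspace_set L (x - y).
Proof.
rewrite /quot_map; split => [/eqP|xy].
  by rewrite -Quotient.idealrBE => /asboolP.
by apply/eqP; rewrite -Quotient.idealrBE; apply/asboolP.
Qed.

Lemma quot_mapD x y : quot_map (x + y) = quot_map x + quot_map y.
Proof. by rewrite /quot_map raddfD. Qed.

Let scale (a : R) (u : quot_type) : quot_type :=
  quot_map (a *: repr (u : quot)).

Let scale_map a x : scale a (quot_map x) = quot_map (a *: x).
Proof.
apply/quot_mapE; rewrite -scalerBr -[_ *: _]addr0.
apply: subspaceP; last exact: subspace0.
by apply/quot_mapE; rewrite /quot_map reprK.
Qed.

Let scaleA a b u : scale a (scale b u) = scale (a * b) u.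
Proof.
by have [x <-] := quot_map_surj u; rewrite !scale_map scalerA.
Qed.

Let scale1 : left_id 1 scale.
Proof.
by move=> u; have [x <-] := quot_map_surj u; rewrite scale_map scale1r.
Qed.

Let scaleDr : right_distributive scale +%R.
Proof.
move=> a u v; have [x <-] := quot_map_surj u; have [y <-] := quot_map_surj v.
by rewrite -quot_mapD !scale_map scalerDr quot_mapD.
Qed.

Let scaleDl u : {morph scale^~ u : a b / a + b}.
Proof.
move=> a b; have [x <-] := quot_map_surj u.
by rewrite !scale_map scalerDl quot_mapD.
Qed.

HB.instance Definition _ := GRing.Zmodule_isLmodule.Build R quot_type
  scaleA scale1 scaleDr scaleDl.

Lemma quot_mapZ a x : quot_map (a *: x) = a *: quot_map x.
Proof. by rewrite -scale_map. Qed.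

Let reps (u : quot_type) : set R := [set `|x| | x in [set x | quot_map x = u]].

Let quot_norm (u : quot_type) : R := inf (reps u).

Let reps_has_inf u : has_inf (reps u).
Proof.
split; last by exists 0 => _ [x _ <-]; exact: normr_ge0.
by have [x xu] := quot_map_surj u; exists `|x|, x.
Qed.

Let quot_norm_le u x : quot_map x = u -> quot_norm u <= `|x|.
Proof. by move=> xu; apply: ge_inf; [case: (reps_has_inf u)|exists x]. Qed.

Let quot_norm_adh u e : 0 < e ->
  exists2 x, quot_map x = u & `|x| < quot_norm u + e.
Proof.
move=> e0; have [_ [x xu <-] xe] := inf_adherent e0 (reps_has_inf u).
by exists x.
Qed.

Let quot_ler_normD u v : quot_norm (u + v) <= quot_norm u + quot_norm v.
Proof.
apply/ler_addgt0Pl => e e0; have e20 : 0 < e / 2 by rewrite divr_gt0.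
have [x xu xe] := quot_norm_adh u e20; have [y yv ye] := quot_norm_adh v e20.
apply: (@le_trans _ _ `|x + y|).
  by apply: quot_norm_le; rewrite quot_mapD xu yv.
apply: (le_trans (ler_normD _ _)).
rewrite {1}(splitr e) addrC addrACA [leRHS]addrC [_ / _ + quot_norm u]addrC.
rewrite [e / 2 + _]addrC lerD// ltW//.
Qed.

Let quot_normZ_le (a : R) u : quot_norm (a *: u) <= `|a| * quot_norm u.
Proof.
have [->|a0] := eqVneq a 0.
  rewrite normr0 mul0r scale0r -[leRHS](@normr0 _ F); apply: quot_norm_le.
  by rewrite -(scale0r (0 : F)) quot_mapZ scale0r.
rewrite -ler_pdivrMl ?normr_gt0//; apply: lb_le_inf.
  by case: (reps_has_inf u).
move=> _ [x xu <-]; rewrite ler_pdivrMl ?normr_gt0// -normrZ.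
by apply: quot_norm_le; rewrite quot_mapZ xu.
Qed.

Let quot_normrZ (a : R) u : quot_norm (a *: u) = `|a| * quot_norm u.
Proof.
apply/eqP; rewrite eq_le quot_normZ_le /=.
have [->|a0] := eqVneq a 0.
  rewrite normr0 mul0r; apply: lb_le_inf; first by case: (reps_has_inf (0 *: u)).
  by move=> _ [x _ <-].
rewrite -ler_pdivlMl ?normr_gt0// -normfV.
by have := quot_normZ_le a^-1 (a *: u); rewrite scalerA mulVf// scale1r.
Qed.

Let quot_normr0_eq0 u : quot_norm u = 0 -> u = 0.
Proof.
have [x <-] := quot_map_surj u => x0.
rewrite -[0](_ : quot_map 0 = 0); last first.
  by rewrite -(scale0r (0 : F)) quot_mapZ scale0r.
apply/quot_mapE; rewrite subr0; apply: closed_subspaceP.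
move=> B /nbhs_ballP[e /= e0 xB].
have [y yx] := quot_norm_adh (quot_map x) e0; rewrite x0 add0r => ye.
exists (x - y); split; first by apply/quot_mapE.
apply: xB; rewrite -ball_normE /= opprB addrCA subrr addr0 //.
Qed.

HB.instance Definition _ := Lmodule_isNormed.Build R quot_type
  quot_ler_normD quot_normrZ quot_normr0_eq0.

Lemma quot_normE (u : quot_type) :
  `|u| = inf [set `|x| | x in [set x | quot_map x = u]].
Proof. by []. Qed.

End Quotient.

Section SubMetric.
Context {R : realType} {X : metricType R} (A : set X).

Let sub_dist (x y : set_type A) : R := mdist (set_val x) (set_val y).

Let sub_dist_ge0 x y : 0 <= sub_dist x y.
Proof. exact: mdist_ge0. Qed.

Let sub_dist_positivity x y : sub_dist x y = 0 -> x = y.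
Proof. by move=> /mdist_positivity xy; exact: val_inj. Qed.

Let sub_ballE (x : set_type A) d : ball x d = [set y | sub_dist x y < d].
Proof.
rewrite -[LHS]/(set_val @^-1` (ball (set_val x) d)).
by rewrite ballEmdist.
Qed.

HB.instance Definition _ := PseudoMetric_isMetric.Build R (set_type A)
  sub_dist_ge0 sub_dist_positivity sub_ballE.

End SubMetric.

(* The library does not make normed modules instances of [metricType]; the
   alias [norm_metric V] carries the distance `|x - y|. *)
Definition norm_metric (R : realType) (V : normedModType R) : Type := V.

Section NormMetric.
Context {R : realType} (V : normedModType R).

HB.instance Definition _ := PseudoMetric.copy (norm_metric V) V.

Let norm_dist (x y : norm_metric V) : R := `|(x : V) - (y : V)|.

Let norm_dist_ge0 x y : 0 <= norm_dist x y.
Proof. exact: normr_ge0. Qed.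

Let norm_dist_positivity x y : norm_dist x y = 0 -> x = y.
Proof. by move=> /normr0_eq0/eqP; rewrite subr_eq0 => /eqP. Qed.

Let norm_ballE (x : norm_metric V) d : ball x d = [set y | norm_dist x y < d].
Proof. by rewrite -[LHS]/(@ball R V x d) -ball_normE. Qed.

HB.instance Definition _ := PseudoMetric_isMetric.Build R (norm_metric V)
  norm_dist_ge0 norm_dist_positivity norm_ballE.

End NormMetric.

Record pointed_metric (R : realType) := PointedMetric {
  pm_space :> metricType R;
  pm_point : pm_space
}.

Definition norm_pm (R : realType) (V : normedModType R) : pointed_metric R :=
  PointedMetric (0 : norm_metric V).

Definition sub_pm (R : realType) (X : pointed_metric R) (A : set X)
    (A0 : A (pm_point X)) : pointed_metric R :=
  PointedMetric (SigSub (mem_set A0) : set_type A).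

Section Lipschitz.
Context {R : realType}.

Definition lip_bounds (X Y : metricType R) (f : X -> Y) : set R :=
  [set k | 0 <= k /\ forall x y, mdist (f x) (f y) <= k * mdist x y].

Definition Lip (X Y : metricType R) (f : X -> Y) : R := inf (lip_bounds f).

Definition Lip0 (X Y : pointed_metric R) : set (X -> Y) :=
  [set f | f (pm_point X) = pm_point Y /\ lip_bounds f !=set0].

End Lipschitz.

Notation banach := completeNormedModType.

Section BoundedOperators.
Context {R : realType}.

Definition bounded_op (E F : normedModType R) : set (E -> F) :=
  [set T | linear T /\ exists c : R, forall x, `|T x| <= c * `|x|].

Definition op_norm (E F : normedModType R) (T : E -> F) : R :=
  sup [set `|T x| | x in [set x | `|x| <= 1]].

End BoundedOperators.

(* Pietsch's axioms, with complete components. Closure under scalars and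
   finite-rank operators, homogeneity and op_norm T <= ideal_norm T follow from
   [ideal_id], [ideal_add] and [ideal_comp]. *)
Record banach_ideal (R : realType) := BanachIdeal {
  ideal_ops : forall E F : banach R, set (E -> F);
  ideal_norm : forall E F : banach R, (E -> F) -> R;
  ideal_bounded : forall (E F : banach R) (T : E -> F),
    ideal_ops T -> bounded_op T;
  ideal_norm_ge0 : forall (E F : banach R) (T : E -> F),
    ideal_ops T -> 0 <= ideal_norm T;
  ideal_id : ideal_ops (idfun : (R^o : banach R) -> (R^o : banach R)) /\
    ideal_norm (idfun : (R^o : banach R) -> (R^o : banach R)) = 1;
  ideal_add : forall (E F : banach R) (S T : E -> F),
    ideal_ops S -> ideal_ops T ->
    ideal_ops (S \+ T) /\ ideal_norm (S \+ T) <= ideal_norm S + ideal_norm T;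
  ideal_comp : forall (E0 E F F0 : banach R)
      (U : E0 -> E) (T : E -> F) (S : F -> F0),
    bounded_op U -> ideal_ops T -> bounded_op S ->
    ideal_ops (S \o T \o U) /\
    ideal_norm (S \o T \o U) <= op_norm S * ideal_norm T * op_norm U;
  ideal_complete : forall (E F : banach R) (T : nat -> E -> F),
    (forall n, ideal_ops (T n)) ->
    (forall e : R, 0 < e -> exists N, forall m n,
       (N <= m)%N -> (N <= n)%N -> ideal_norm (T m \- T n) < e) ->
    exists2 T0 : E -> F, ideal_ops T0 &
      ideal_norm (T n \- T0) @[n --> \oo] --> 0
}.

(* Classes of operators between Banach spaces, and of maps from pointed metric
   spaces to Banach spaces; the norms are only meaningful on the components and
   are extended-real valued so that they can be infima and suprema. *)
Record op_class (R : realType) := OpClass {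
  op_component : forall E F : banach R, set (E -> F);
  op_class_norm : forall E F : banach R, (E -> F) -> \bar R
}.

Record lip_class (R : realType) := LipClass {
  lip_component : forall (X : pointed_metric R) (E : banach R), set (X -> E);
  lip_class_norm : forall (X : pointed_metric R) (E : banach R),
    (X -> E) -> \bar R
}.

Definition same_class (R : realType) (J K : op_class R) : Prop :=
  forall E F : banach R,
    @op_component R J E F = @op_component R K E F /\
    forall T : E -> F, op_component J T -> op_class_norm J T = op_class_norm K T.

Section Classes.
Context {R : realType}.

Definition ideal_class (A : banach_ideal R) : op_class R :=
  OpClass (@ideal_ops R A)
    (fun E F T => if `[< ideal_ops A T >] then (ideal_norm A T)%:E else +oo%E).

Definition op_max_norm (A : op_class R) (E F : banach R) (T : E -> F) :
    \bar R :=
  ereal_sup [set c | exists (M : subspace E) (fM : finite_dim (subspace_type M))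
      (L : closed_subspace F) (fL : finite_dim (quot_type L)),
    c = @op_class_norm R A (finite_dim_banach fM) (finite_dim_banach fL)
          (quot_map L \o T \o @subspace_incl R E M)].

Definition op_max (A : op_class R) : op_class R :=
  OpClass (fun E F => [set T : E -> F | bounded_op T /\
                         (op_max_norm A T < +oo)%E])
    (@op_max_norm A).

Definition maximal (A : banach_ideal R) : Prop :=
  same_class (ideal_class A) (op_max (ideal_class A)).

Definition ideal_Lip (A : banach_ideal R) (X : pointed_metric R)
    (E : banach R) : set (X -> E) :=
  [set f | exists (G : banach R) (g : X -> G) (S : G -> E),
    [/\ @Lip0 R X (norm_pm G) g, ideal_ops A S & f = S \o g]].

Definition Lip_ideal_Lip_factor (A : banach_ideal R) (X : pointed_metric R)
    (E G1 G2 : banach R) (g1 : X -> G1) (T : G1 -> G2) (g2 : G2 -> E)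
    (f : X -> E) : Prop :=
  [/\ @Lip0 R X (norm_pm G1) g1, ideal_ops A T,
      @Lip0 R (norm_pm G2) (norm_pm E) g2 & f = g2 \o T \o g1].

Definition Lip_ideal_Lip (A : banach_ideal R) : lip_class R :=
  LipClass
    (fun X E => [set f | exists (G1 G2 : banach R)
         (g1 : X -> G1) (T : G1 -> G2) (g2 : G2 -> E),
       Lip_ideal_Lip_factor A g1 T g2 f])
    (fun X E f => ereal_inf [set c | exists (G1 G2 : banach R)
         (g1 : X -> G1) (T : G1 -> G2) (g2 : G2 -> E),
       Lip_ideal_Lip_factor A g1 T g2 f /\
       c = (@Lip R X (norm_metric G1) g1 * ideal_norm A T *
            @Lip R (norm_metric G2) (norm_metric E) g2)%:E]).

Definition lip_max_norm (I : lip_class R) (X : pointed_metric R)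
    (E : banach R) (f : X -> E) : \bar R :=
  ereal_sup [set c | exists (X0 : set X) (X00 : X0 (pm_point X))
      (L : closed_subspace E) (fL : finite_dim (quot_type L)),
    finite_set X0 /\
    c = @lip_class_norm R I (sub_pm X00) (finite_dim_banach fL)
          (quot_map L \o f \o set_val)].

Definition lip_max (I : lip_class R) : lip_class R :=
  LipClass (fun X E => [set f : X -> E | @Lip0 R X (norm_pm E) f /\
                          (lip_max_norm I f < +oo)%E])
    (@lip_max_norm I).

Definition linear_part (J : lip_class R) : op_class R :=
  OpClass
    (fun E F => [set T : E -> F |
       @lip_component R J (norm_pm E) F T /\ bounded_op T])
    (fun E F T => @lip_class_norm R J (norm_pm E) F T).

Definition gateaux_differentiable (M F : normedModType R) (f : M -> F)
    (x0 : M) : Prop :=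
  exists2 D : M -> F, bounded_op D &
    forall x : M, t^-1 *: (f (x0 + t *: x) - f x0) @[t --> (0 : R)^'] --> D x.

End Classes.

(* Main.v *)
(* Let [S : M -> N] be a restriction of [T] followed by a quotient map, with [M]
   and [N] finite-dimensional; by maximality it suffices to bound its ideal norm
   by the norm [C] of [T] in the maximal hull. On each finite [k] in [M] there is
   a factorization [S = h_k o T_k o g_k] with [g_k], [h_k] nonexpansive and [T_k]
   of ideal norm at most [C]. Along an ultrafilter the [T_k o g_k] have a limit
   [f : M -> l_oo(Gamma)], where [Gamma] consists of the families of norm-one
   functionals on the targets of the [T_k]; it is a Lipschitz map followed by an
   operator of the ideal, because finitely many elements of [l_oo(Gamma)] factor
   up to [e] through finitely many points of [Gamma], hence through a single
   [T_k]. A point of Gateaux differentiability of [f] then yields a scale and a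
   single [k] at which [T_k o g_k] is almost additive on an arbitrarily large
   finite grid. There everything can be linearized: averaging the increments of
   [g_k] over a box of the grid gives a linear [L] of norm close to [1], averaging
   those of [h_k] (and the Hahn-Banach theorem, since the target of [T_k] is
   infinite-dimensional) gives a linear [B] of norm close to [1], and [S] is close
   to [B o T_k o L], whose ideal norm is almost at most [C]. *)
From HB Require Import structures.
From mathcomp Require Import all_boot all_order all_algebra.
From mathcomp Require Import all_classical all_reals all_analysis.
From mathcomp Require Import lra zify ring.
Require Import Defs.

Set Implicit Arguments.
Unset Strict Implicit.
Unset Printing Implicit Defensive.

Import Order.TTheory GRing.Theory Num.Theory.
Import numFieldNormedType.Exports.

Local Open Scope classical_set_scope.
Local Open Scope ring_scope.

(** Neither [g_k] nor [h_k] can be differentiated: their Banach spaces are arbitrary, [g_k] is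
    meaningful only at finitely many points, and the differentiability hypothesis concerns maps that
    end with an operator of the ideal. So one limit map has to collect all the [T_k o g_k], and what
    its derivative says has to be brought back to a single [k] as finitely many inequalities; a
    Gateaux derivative is enough for that. This is also why [Gamma] consists of families of
    functionals: one index can norm a given vector for every [k] at once. The order of the choices
    shapes the statements. The grid size and the tolerances must be known before the base point, the
    scale and [k] are obtained, hence the averaging and lifting lemmas have constants that do not
    depend on the spaces and maps to which they are applied. The nonlinear [h_k] is controlled on a
    small finite set only, so the operator replacing it is found by duality: a finite system of
    approximate equations is solvable unless a linear relation obstructs it, and averaging rules out
    such relations. *)

(** * Linear maps as plain functions *)

Section LinearMaps.
Context {R : realType} {U V : lmodType R} (f : U -> V) (lin_f : linear f).

Lemma linear_map0 : f 0 = 0.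
Proof.
have := lin_f 1 0 0; rewrite !scale1r addr0 => /(congr1 (fun z => z - f 0)).
by rewrite addrK subrr.
Qed.

Lemma linear_mapD x y : f (x + y) = f x + f y.
Proof. by have := lin_f 1 x y; rewrite !scale1r. Qed.

Lemma linear_mapZ a x : f (a *: x) = a *: f x.
Proof. by have := lin_f a x 0; rewrite linear_map0 !addr0. Qed.

Lemma linear_mapN x : f (- x) = - f x.
Proof. by rewrite -scaleN1r linear_mapZ scaleN1r. Qed.

Lemma linear_mapB x y : f (x - y) = f x - f y.
Proof. by rewrite linear_mapD linear_mapN. Qed.

Lemma linear_map_sum (I : Type) (r : seq I) (P : pred I) (F : I -> U) :
  f (\sum_(i <- r | P i) F i) = \sum_(i <- r | P i) f (F i).
Proof. by apply: (big_morph f linear_mapD linear_map0). Qed.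

Lemma linear_map_comb (I : Type) (r : seq I) (P : pred I) (a : I -> R) (F : I -> U) :
  f (\sum_(i <- r | P i) a i *: F i) = \sum_(i <- r | P i) a i *: f (F i).
Proof. by rewrite linear_map_sum; apply: eq_bigr => i _; rewrite linear_mapZ. Qed.

End LinearMaps.

Lemma linear_comp (R : realType) (U V W : lmodType R) (g : V -> W) (f : U -> V) :
  linear g -> linear f -> linear (g \o f).
Proof. by move=> lg lf a x y /=; rewrite lf lg. Qed.

(** * The Hahn-Banach theorem *)

Section HahnBanach.
Context {R : realType} {V : lmodType R}.
Implicit Types p q : V -> R.

Definition sublinear p := (forall x y, p (x + y) <= p x + p y) /\
  (forall (a : R) x, 0 <= a -> p (a *: x) = a * p x).

Lemma sublinearW p : p 0 = 0 -> (forall x y, p (x + y) <= p x + p y) ->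
  (forall (a : R) x, 0 < a -> p (a *: x) <= a * p x) -> sublinear p.
Proof.
move=> p0 pD pZ; split => // a x; rewrite le_eqVlt => /orP[/eqP <-|a0].
  by rewrite scale0r mul0r.
have an0 : a != 0 by rewrite gt_eqF.
apply/eqP; rewrite eq_le pZ //=.
rewrite -ler_pdivlMl //.
by have := pZ a^-1 (a *: x); rewrite scalerA mulVf // scale1r; apply; rewrite invr_gt0.
Qed.

Lemma sublinear0 p : sublinear p -> p 0 = 0.
Proof. by case=> _ /(_ 0 0 (lexx 0)); rewrite scale0r mul0r. Qed.

Lemma sublinear_opp p x : sublinear p -> - p (- x) <= p x.
Proof.
move=> sp; rewrite lerNl -subr_ge0 opprK -(sublinear0 sp) -(addNr x).
by case: sp => + _; apply.
Qed.

(** The largest sublinear minorant of a sublinear [p] whose value at [- y] is at most [- p y]. It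
    serves twice: minimal functionals are fixed by it, and a linear functional below it takes the
    value [p y] at [y]. *)
Definition sublinear_shift p y x : R :=
  inf [set p (x + s *: y) - s * p y | s in [set s : R | 0 <= s]].

Section Shift.
Context p (sp : sublinear p) (y : V).

Let E x := [set p (x + s *: y) - s * p y | s in [set s : R | 0 <= s]].

Let E_lb x : lbound (E x) (- p (- x)).
Proof.
move=> _ [s /= s0 <-]; case: sp => pD pZ.
rewrite lerBrDr addrC lerBlDr -pZ //.
have := pD (x + s *: y) (- x); rewrite addrAC subrr add0r; apply.
Qed.

Let E_neq0 x : E x !=set0.
Proof. by exists (p (x + 0 *: y) - 0 * p y), 0 => /=. Qed.

Lemma sublinear_shift_le x s : 0 <= s ->
  sublinear_shift p y x <= p (x + s *: y) - s * p y.
Proof.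
move=> s0; apply: ge_inf; last by exists s.
by exists (- p (- x)); exact: E_lb.
Qed.

Let le_shift x a : (forall s, 0 <= s -> a <= p (x + s *: y) - s * p y) ->
  a <= sublinear_shift p y x.
Proof.
move=> h; apply: lb_le_inf; first exact: E_neq0.
by move=> _ [s /= s0 <-]; exact: h.
Qed.

Lemma sublinear_shiftP : sublinear (sublinear_shift p y).
Proof.
have [pD pZ] := sp; apply: sublinearW.
- apply/eqP; rewrite eq_le; apply/andP; split.
    apply: le_trans (sublinear_shift_le _ (lexx 0)) _.
    by rewrite scale0r mul0r addr0 subr0 (sublinear0 sp).
  by apply: le_shift => s s0; rewrite add0r pZ // subrr.
- move=> x x'; rewrite -lerBlDr; apply: le_shift => s s0.
  rewrite lerBlDr -lerBlDl; apply: le_shift => s' s'0.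
  rewrite lerBlDl; apply: le_trans (sublinear_shift_le _ (addr_ge0 s0 s'0)) _.
  rewrite addrACA -opprD -mulrDl lerB // scalerDl addrACA.
  exact: pD.
- move=> a x a0; rewrite -ler_pdivrMl //; apply: le_shift => s s0.
  rewrite ler_pdivrMl //.
  apply: le_trans (sublinear_shift_le _ (mulr_ge0 (ltW a0) s0)) _.
  by rewrite -scalerA -scalerDr (pZ _ _ (ltW a0)) mulrBr mulrA.
Qed.

End Shift.

(** For subadditivity two members of the chain are compared and the smaller one is used at both
    points. All members lie above [- p (- x)] at [x], so the infima are finite. *)
Lemma sublinear_inf (A : set (V -> R)) p : A !=set0 ->
  (forall f, A f -> sublinear f /\ forall x, f x <= p x) ->
  (forall f g, A f -> A g -> (forall x, f x <= g x) \/ (forall x, g x <= f x)) ->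
  let q x := inf [set f x | f in A] in
  sublinear q /\ forall f, A f -> forall x, q x <= f x.
Proof.
move=> A0 Ap Atot q.
have qle f x : A f -> q x <= f x.
  move=> Af; apply: ge_inf; last by exists f.
  exists (- p (- x)) => _ [g Ag <-]; have [sg gp] := Ap _ Ag.
  by apply: le_trans (sublinear_opp x sg); rewrite lerN2.
have le_qx x a : (forall f, A f -> a <= f x) -> a <= q x.
  move=> h; apply: lb_le_inf.
    by case: A0 => f Af; exists (f x), f.
  by move=> _ [f Af <-]; exact: h.
split; last by move=> f Af x; exact: qle.
apply: sublinearW.
- case: A0 => f0 Af0; apply/eqP; rewrite eq_le; apply/andP; split.
    by rewrite -(sublinear0 (Ap _ Af0).1); exact: qle.
  by apply: (le_qx) => f Af; rewrite (sublinear0 (Ap _ Af).1).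
- move=> x y; rewrite -lerBlDr; apply: (le_qx) => f Af.
  rewrite lerBlDr -lerBlDl; apply: (le_qx) => g Ag; rewrite lerBlDl.
  have [fg|gf] := Atot _ _ Af Ag.
    apply: le_trans (qle _ _ Af) _; apply: le_trans ((Ap _ Af).1.1 _ _) _.
    by rewrite lerD2l.
  apply: le_trans (qle _ _ Ag) _; apply: le_trans ((Ap _ Ag).1.1 _ _) _.
  by rewrite lerD2r.
- move=> a x a0; rewrite -ler_pdivrMl //; apply: (le_qx) => f Af.
  by rewrite ler_pdivrMl // -((Ap _ Af).1.2 _ _ (ltW a0)); exact: qle.
Qed.

(* A minimal sublinear functional [p] satisfies [sublinear_shift p y = p] for
   every [y], which makes it additive. *)
Theorem hahn_banach p : sublinear p ->
  exists2 f : V -> R, linear (f : V -> R^o) & forall x, f x <= p x.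
Proof.
move=> sp; pose T := {f : V -> R | sublinear f /\ forall x, f x <= p x}.
pose rel (f g : T) := `[< forall x, sval g x <= sval f x >].
have [|||A Atot|[f [sf fp]] fmin] := @Zorn T rel.
- by move=> f; apply/asboolP => x.
- move=> f g h /asboolP fg /asboolP gh; apply/asboolP => x.
  exact: le_trans (gh x) (fg x).
- move=> [f Pf] [g Pg] /asboolP /= fg /asboolP /= gf; apply: eq_exist.
  by apply/funext => x; apply/eqP; rewrite eq_le fg gf.
- have [[f0 Af0]|A0] := pselect (A !=set0); last first.
    exists (exist _ p (conj sp (fun x => lexx _))) => f Af.
    by exfalso; apply: A0; exists f.
  pose B := [set sval f | f in A].
  have [|||sq qle] := @sublinear_inf B p.
  + by exists (sval f0), f0.
  + by move=> _ [[f Pf] Af <-].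
  + move=> _ _ [f Af <-] [g Ag <-].
    by have [/asboolP|/asboolP] := Atot _ _ Af Ag; [right|left].
  + set q := (q in sublinear q) in sq qle *.
    have qp x : q x <= p x.
      by apply: le_trans ((proj2_sig f0).2 x); apply: qle; exists f0.
    exists (exist _ q (conj sq qp)) => f Af; apply/asboolP => x /=.
    by apply: qle; exists f.
exists f => //.
have shf x y : f x <= f (x + y) - f y.
  have := sublinear_shift_le sf y x ler01; rewrite scale1r mul1r.
  suff -> : sublinear_shift f y = f by [].
  have sle z : sublinear_shift f y z <= f z.
    have := sublinear_shift_le sf y z (lexx 0).
    by rewrite scale0r addr0 mul0r subr0.
  have sp' : sublinear (sublinear_shift f y) /\
      forall z, sublinear_shift f y z <= p z.
    by split=> [|z]; [exact: sublinear_shiftP|exact: le_trans (sle z) (fp z)].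
  have := fmin (exist _ _ sp').
  by move=> /(_ _)/(congr1 sval) /= -> //; apply/asboolP.
have fD x y : f (x + y) = f x + f y.
  by apply/eqP; rewrite eq_le sf.1 /= -lerBrDr.
have fN x : f (- x) = - f x.
  by apply/eqP; rewrite -addr_eq0 addrC -fD subrr (sublinear0 sf).
move=> a x y; rewrite fD; congr (_ + _).
have [a0|/ltW a0] := leP 0 a; first exact: sf.2.
rewrite -[a]opprK scaleNr fN sf.2 ?oppr_ge0 //.
by rewrite scaleNr.
Qed.

Lemma hahn_banach_attained p y : sublinear p ->
  exists f : V -> R,
    [/\ linear (f : V -> R^o), forall x, f x <= p x & f y = p y].
Proof.
move=> sp; have [f lf fle] := hahn_banach (sublinear_shiftP sp y).
have fp x : f x <= p x.
  apply: le_trans (fle x) _; have := sublinear_shift_le sp y x (lexx 0).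
  by rewrite scale0r addr0 mul0r subr0.
exists f; split => //; apply/eqP; rewrite eq_le fp /=.
have := le_trans (fle (- y)) (sublinear_shift_le sp y (- y) ler01).
rewrite (linear_mapN lf) scale1r addNr (sublinear0 sp) mul1r sub0r.
by rewrite lerN2.
Qed.

End HahnBanach.

Definition functional (R : realType) (V : normedModType R) (c : R) (f : V -> R) :=
  linear (f : V -> R^o) /\ forall x, `|f x| <= c * `|x|.

(** Both [c = 1] and [c = D], the bound of the functionals on the spaces [G1 k], are used below. *)
Lemma norming_functional (R : realType) (V : normedModType R) (c : R) (y : V) :
  0 <= c -> exists f : V -> R, functional c f /\ f y = c * `|y|.
Proof.
move=> c0; have sp : sublinear (fun x : V => c * `|x|).
  split=> [x z|a x a0]; first by rewrite -mulrDr ler_wpM2l // ler_normD.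
  by rewrite normrZ ger0_norm // mulrCA.
have [f [lf fle fy]] := hahn_banach_attained y sp.
exists f; split => //; split => // x; rewrite ler_norml fle andbT lerNl.
by have := fle (- x); rewrite (linear_mapN lf) normrN.
Qed.

(** * Finite-dimensional spaces and spaces of bounded functions *)

Definition coordinate_system (R : realType) (V : normedModType R) (K : R) (n : nat)
    (b : 'I_n -> V) (c : 'I_n -> V -> R) :=
  [/\ forall i, functional K (c i), forall x, x = \sum_(i < n) c i x *: b i &
      forall (a : 'I_n -> R) i, c i (\sum_(j < n) a j *: b j) = a i].

Lemma ler_mx_coord (R : realType) m n (A : 'M[R]_(m, n)) i j : `|A i j| <= `|A|.
Proof.
rewrite [leRHS]mx_normrE.
exact: (le_bigmax _ (fun ij : 'I_m * 'I_n => `|A ij.1 ij.2|) (i, j)).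
Qed.

(** A spanning family of minimal length is free, and [coord_lower_bound] then bounds its coordinate
    functionals. *)
Lemma finite_dim_coordinates (R : realType) (V : normedModType R) :
  finite_dim V -> exists (n : nat) (b : 'I_n -> V) (c : 'I_n -> V -> R),
    exists2 K : R, 0 < K & coordinate_system K b c.
Proof.
move=> Vfin.
pose spans n := exists e : 'I_n -> V,
  forall x : V, exists a : 'I_n -> R, x = \sum_(i < n) a i *: e i.
have ex : exists n, `[< spans n >].
  by case: Vfin => n sn; exists n; apply/asboolP.
have [n /asboolP [e sp] nmin] := ex_minnP ex.
have fr (w : 'rV[R]_n) : \sum_(i < n) w ord0 i *: e i = 0 -> w = 0.
  move=> w0; apply/rowP => k; rewrite mxE; apply/eqP; apply: contraT => wk.
  case: n => [|n] in ex e sp nmin w w0 k wk *; first by case: k wk.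
  suff : spans n by move=> /asboolP /nmin; rewrite ltnn.
  have ek : e k = \sum_(i < n) (- (w ord0 (lift k i) / w ord0 k)) *: e (lift k i).
    move: w0; rewrite (bigD1_ord k) //= => /eqP; rewrite addr_eq0 => /eqP w0.
    rewrite -[LHS]scale1r -(mulVf wk) -scalerA w0 scalerN scaler_sumr -sumrN.
    by apply: eq_bigr => i _; rewrite scalerA scaleNr mulrC.
  exists (fun i => e (lift k i)) => x; have [a ->] := sp x.
  exists (fun i => a (lift k i) - a k * (w ord0 (lift k i) / w ord0 k)).
  rewrite (bigD1_ord k) //= ek scaler_sumr -big_split /=.
  by apply: eq_bigr => i _; rewrite scalerA -scalerDl mulrN addrC.
have [k k0 kP] := coord_lower_bound fr.
pose coords x := \row_i (projT1 (cid (sp x))) i.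
have coordsP x : x = \sum_(i < n) coords x ord0 i *: e i.
  rewrite [LHS](projT2 (cid (sp x))); apply: eq_bigr => i _.
  by rewrite mxE.
have coords_uniq (a : 'rV[R]_n) x : x = \sum_(i < n) a ord0 i *: e i -> coords x = a.
  move=> xE; apply/eqP; rewrite -subr_eq0; apply/eqP/fr.
  under eq_bigr => i _ do rewrite !mxE scalerBl.
  rewrite sumrB -xE [X in _ - X]coordsP; apply/eqP; rewrite subr_eq0; apply/eqP.
  by apply: eq_bigr => i _; rewrite mxE.
exists n, e, (fun i x => coords x ord0 i), k^-1; first by rewrite invr_gt0.
split=> //.
- move=> i; split=> [a x y|x].
    rewrite (coords_uniq (a *: coords x + coords y)) ?mxE // {1}[x]coordsP.
    rewrite {1}[y]coordsP scaler_sumr -big_split; apply: eq_bigr => j _ /=.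
    by rewrite !mxE scalerA scalerDl.
  rewrite ler_pdivlMl // {2}[x]coordsP; apply: le_trans (kP _).
  by rewrite ler_pM2l //; exact: ler_mx_coord.
- move=> a i; rewrite (coords_uniq (\row_i a i)) ?mxE //.
  by apply: eq_bigr => j _; rewrite mxE.
Qed.

Lemma coordinate_dual (R : realType) (V : normedModType R) K n (b : 'I_n -> V) c i j :
  coordinate_system K b c -> c i (b j) = (j == i)%:R.
Proof.
move=> [_ _ cu]; rewrite eq_sym -(cu (fun k => (k == j)%:R) i); congr (c i _).
rewrite (bigD1 j) //= eqxx scale1r big1 ?addr0 // => k /negPf ->.
by rewrite scale0r.
Qed.

Section BoundedFunctions.
Context {R : realType} (S : Type).

Definition bounded_pred : {pred S -> R^o} :=
  fun f => `[< exists c : R, forall s, `|f s| <= c >].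

Let bounded_pred_closed : GRing.submod_closed bounded_pred.
Proof.
split; first by apply/asboolP; exists 0 => s; rewrite normr0.
move=> a f g /asboolP[c fc] /asboolP[d gd]; apply/asboolP.
exists (`|a| * c + d) => s; apply: le_trans (ler_normD _ _) _.
by rewrite lerD // normrM ler_wpM2l.
Qed.

HB.instance Definition _ :=
  GRing.isSubmodClosed.Build R (S -> R^o) bounded_pred bounded_pred_closed.

Definition bounded_fun : Type := {f : S -> R^o | bounded_pred f}.

HB.instance Definition _ := SubChoice.on bounded_fun.
HB.instance Definition _ := [SubChoice_isSubLmodule of bounded_fun by <:].

Definition bounded_eval (f : bounded_fun) (s : S) : R := val f s.

Lemma bounded_evalP f : exists c : R, forall s, `|bounded_eval f s| <= c.
Proof. by have /asboolP := valP f. Qed.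

Definition mk_bounded (f : S -> R) (fb : exists c : R, forall s, `|f s| <= c) :
  bounded_fun := Sub (f : S -> R^o) (asboolT fb).

Let bnorm (f : bounded_fun) : R := sup [set `|bounded_eval f s| | s in setT].

Let bnorm_ge f s : `|bounded_eval f s| <= bnorm f.
Proof.
apply: ub_le_sup; last by exists s.
by have [c fc] := bounded_evalP f; exists c => _ [t _ <-].
Qed.

Let bnorm_le f c : 0 <= c -> (forall s, `|bounded_eval f s| <= c) -> bnorm f <= c.
Proof.
move=> c0 fc; rewrite /bnorm; set E := (X in sup X).
have [E0|E0] := pselect (E !=set0); first by apply: ge_sup => // _ [s _ <-].
(* For empty [S] the supremum is taken over the empty set and is 0 by convention. *)
by rewrite (_ : E = set0) ?sup0 // -subset0 => x Ex; apply: E0; exists x.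
Qed.

Let bnorm_ge0 f : 0 <= bnorm f.
Proof.
have [[s _]|S0] := pselect (exists s : S, True).
  exact: le_trans (normr_ge0 _) (bnorm_ge f s).
rewrite /bnorm (_ : [set _ | _ in _] = set0) ?sup0 // -subset0 => x [s].
by case: S0; exists s.
Qed.

Let bnormD f g : bnorm (f + g) <= bnorm f + bnorm g.
Proof.
apply: bnorm_le => [|s]; first by rewrite addr_ge0.
by apply: le_trans (ler_normD _ _) _; rewrite lerD.
Qed.

Let bnormZ_le (a : R) f : bnorm (a *: f) <= `|a| * bnorm f.
Proof.
apply: bnorm_le => [|s]; first by rewrite mulr_ge0.
rewrite [leLHS](_ : _ = `|a| * `|bounded_eval f s|) ?ler_wpM2l //.
by rewrite -normrM.
Qed.

Let bnormZ (a : R) f : bnorm (a *: f) = `|a| * bnorm f.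
Proof.
apply/eqP; rewrite eq_le bnormZ_le /=.
have [->|a0] := eqVneq a 0; first by rewrite normr0 mul0r.
rewrite -ler_pdivlMl ?normr_gt0 // -normfV.
by have := bnormZ_le a^-1 (a *: f); rewrite scalerA mulVf // scale1r.
Qed.

Let bnorm0_eq0 f : bnorm f = 0 -> f = 0.
Proof.
move=> f0; apply/val_inj/funext => s /=; apply/normr0_eq0/eqP.
by rewrite eq_le normr_ge0 andbT -f0; exact: bnorm_ge.
Qed.

HB.instance Definition _ := Lmodule_isNormed.Build R bounded_fun
  bnormD bnormZ bnorm0_eq0.

Lemma bounded_eval_le (f : bounded_fun) s : `|bounded_eval f s| <= `|f|.
Proof. exact: bnorm_ge. Qed.

Lemma bounded_norm_le (f : bounded_fun) c :
  0 <= c -> (forall s, `|bounded_eval f s| <= c) -> `|f| <= c.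
Proof. exact: bnorm_le. Qed.

Lemma bounded_evalD f g s : bounded_eval (f + g) s = bounded_eval f s + bounded_eval g s.
Proof. by []. Qed.

Lemma bounded_evalN f s : bounded_eval (- f) s = - bounded_eval f s.
Proof. by []. Qed.

Lemma bounded_evalB_le f g s :
  `|bounded_eval f s - bounded_eval g s| <= `|f - g|.
Proof. exact: (bounded_eval_le (f - g)). Qed.

Lemma bounded_eval_linear s : linear (bounded_eval^~ s : bounded_fun -> R^o).
Proof. by []. Qed.

Lemma bounded_eval_mk f fb s : bounded_eval (@mk_bounded f fb) s = f s.
Proof. by []. Qed.

Lemma bounded_fun_ext f g : bounded_eval f =1 bounded_eval g -> f = g.
Proof. by move=> fg; apply/val_inj/funext. Qed.

Lemma bounded_fun_complete (F : set_system bounded_fun) :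
  ProperFilter F -> cauchy F -> cvg F.
Proof.
move=> FF /cauchyP Fc.
have evc s : cvg (bounded_eval^~ s @ F).
  apply/cauchy_cvgP/cauchyP => e e0; have [f Ff] := Fc _ e0.
  exists (bounded_eval f s); apply: (@filterS _ F _ (ball f e)) => // g.
  rewrite -!ball_normE /= => fg; apply: le_lt_trans fg.
  exact: bounded_evalB_le.
pose l s := lim (bounded_eval^~ s @ F).
(* Closed balls contain the pointwise limits, which makes the convergence uniform in [s]. *)
have near_l f e : F (ball f e) -> forall s, `|bounded_eval f s - l s| <= e.
  move=> Ff s; apply: (@closed_cvg _ _ F _ (bounded_eval^~ s)
      [set y | `|bounded_eval f s - y| <= e]) (evc s).
    rewrite (_ : [set y | _] = closed_ball_ Num.Def.normr (bounded_eval f s) e) //.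
    exact: closed_closed_ball_.
  apply: filterS Ff => g; rewrite -ball_normE /= => fg.
  by rewrite ltW // (le_lt_trans _ fg) //; exact: bounded_evalB_le.
have lb : exists c : R, forall s, `|l s| <= c.
  have [f Ff] := Fc _ ltr01; exists (`|f| + 1) => s.
  rewrite -[l s](subKr (bounded_eval f s)) (le_trans (ler_normB _ _)) //.
  by rewrite lerD ?bounded_eval_le ?near_l.
apply/cvg_ex; exists (mk_bounded lb); apply/cvgrPdist_le => e e0.
have e20 : 0 < e / 2 by rewrite divr_gt0.
have [f Ff] := Fc _ e20; apply: filterS (Ff) => g; rewrite -ball_normE /= => fg.
rewrite -[X in `|X|](subrKA f) (splitr e) (le_trans (ler_normD _ _)) // lerD ?(ltW fg) //.
rewrite distrC; apply: bounded_norm_le => [|s]; first exact: ltW.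
by rewrite bounded_evalD bounded_evalN bounded_eval_mk near_l.
Qed.

Definition bounded_banach : completeNormedModType R :=
  HB.pack bounded_fun (Uniform_isComplete.Build bounded_fun bounded_fun_complete).

Definition bval (f : bounded_banach) (s : S) : R := bounded_eval (f : bounded_fun) s.

Definition mk_bval (f : S -> R) (fb : exists c : R, forall s, `|f s| <= c) :
  bounded_banach := mk_bounded fb.

Lemma bval_mk f fb s : bval (@mk_bval f fb) s = f s.
Proof. by []. Qed.

Lemma bval_linear s : linear (bval^~ s : bounded_banach -> R^o).
Proof. exact: bounded_eval_linear. Qed.

Lemma bval_le f s : `|bval f s| <= `|f|.
Proof. exact: (@bounded_eval_le f). Qed.

Lemma bval_norm_le f c : 0 <= c -> (forall s, `|bval f s| <= c) -> `|f| <= c.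
Proof. exact: (@bounded_norm_le f). Qed.

Lemma bval_ext f g : bval f =1 bval g -> f = g.
Proof. exact: (@bounded_fun_ext f g). Qed.

End BoundedFunctions.

(** * Closed subspaces of a Banach space *)

Section ClosedSubspace.
Context {R : realType} {E : completeNormedModType R} (L : closed_subspace E).

Lemma subspace_incl_linear (V : normedModType R) (W : subspace V) :
  linear (@subspace_incl R V W).
Proof. by []. Qed.

Lemma subspace_inclP (V : normedModType R) (W : subspace V) x :
  subspace_set W (@subspace_incl R V W x).
Proof. by have /asboolP := valP x. Qed.

Lemma closed_subspace_complete (F : set_system (subspace_type L)) :
  ProperFilter F -> cauchy F -> cvg F.
Proof.
move=> FF /cauchyP Fc.
have : cvg (@subspace_incl R E L @ F).
  apply/cauchy_cvgP/cauchyP => e e0; have [x Fx] := Fc _ e0.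
  exists (subspace_incl x); apply: (@filterS _ F _ (ball x e)) => // y.
  by rewrite -!ball_normE.
move=> /cvg_ex[x Fx].
have Lx : subspace_set L x.
  apply: (closed_cvg (subspace_set L)) Fx; first exact: closed_subspaceP.
  by near=> y; exact: subspace_inclP.
apply/cvg_ex; exists (Sub x (asboolT Lx)); apply/cvgrPdist_lt => e e0.
by move/cvgrPdist_lt: Fx => /(_ _ e0).
Unshelve. all: by end_near. Qed.

Definition closed_subspace_banach : completeNormedModType R :=
  HB.pack (subspace_type L)
    (Uniform_isComplete.Build (subspace_type L) closed_subspace_complete).

Definition closed_incl (x : closed_subspace_banach) : E :=
  subspace_incl (x : subspace_type L).

Lemma closed_incl_linear : linear closed_incl.
Proof. exact: (@subspace_incl_linear E L). Qed.

Lemma closed_inclP x : subspace_set L (closed_incl x).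
Proof. exact: (@subspace_inclP E L x). Qed.

Lemma closed_incl_norm x : `|closed_incl x| = `|x|.
Proof. by []. Qed.

Definition mk_closed (x : E) (Lx : subspace_set L x) : closed_subspace_banach :=
  (Sub x (asboolT Lx) : subspace_type L).

Lemma closed_incl_inj : injective closed_incl.
Proof. exact: val_inj. Qed.

End ClosedSubspace.

(** * Finite-rank operators in an ideal *)

Section OperatorNorm.
Context {R : realType}.

Lemma op_norm_le (E F : normedModType R) (T : E -> F) (c : R) :
  0 <= c -> (forall x, `|T x| <= c * `|x|) -> op_norm T <= c.
Proof.
move=> c0 Tc; apply: ge_sup.
  by exists `|T 0|, 0 => //=; rewrite normr0.
by move=> _ [x /= x1 <-]; apply: le_trans (Tc x) _; rewrite ler_piMr.
Qed.

Lemma op_norm_ge0 (E F : normedModType R) (T : E -> F) :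
  bounded_op T -> 0 <= op_norm T.
Proof.
move=> [lT [c Tc]]; apply: (@le_trans _ _ `|T 0|) => //.
apply: ub_le_sup; last by exists 0 => //=; rewrite normr0.
exists `|c| => _ [x /= x1 <-]; apply: le_trans (Tc x) _.
by apply: le_trans (ler_wpM2r (normr_ge0 x) (ler_norm c)) _; rewrite ler_piMr.
Qed.

End OperatorNorm.

Section IdealBasics.
Context {R : realType} (A : banach_ideal R).

Lemma ideal_comp_le (E0 E F F0 : banach R) (U : E0 -> E) (T : E -> F)
    (S : F -> F0) (u s : R) :
  linear U -> linear S -> 0 <= u -> 0 <= s ->
  (forall x, `|U x| <= u * `|x|) -> (forall y, `|S y| <= s * `|y|) ->
  ideal_ops A T ->
  ideal_ops A (S \o T \o U) /\ ideal_norm A (S \o T \o U) <= s * ideal_norm A T * u.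
Proof.
move=> lU lS u0 s0 Uu Ss AT.
have bU : bounded_op U by split => //; exists u.
have bS : bounded_op S by split => //; exists s.
have [AST] := ideal_comp bU AT bS; split=> //; apply: le_trans b _.
have T0 := ideal_norm_ge0 AT.
by rewrite ler_pM ?mulr_ge0 ?op_norm_ge0 ?op_norm_le // ler_wpM2r ?op_norm_le.
Qed.

(** The operator is the identity of the scalar field, of ideal norm 1, placed between [f] and
    [a |-> a *: y]. *)
Lemma ideal_rank_one (E F : banach R) (f : E -> R) (K : R) (y : F) :
  0 <= K -> functional K f ->
  ideal_ops A (fun x => f x *: y) /\ ideal_norm A (fun x => f x *: y) <= K * `|y|.
Proof.
move=> K0 [lf fK]; have [Aid nid] := ideal_id A.
have := @ideal_comp_le E _ _ F (f : E -> R^o) _ (fun a : R^o => (a : R) *: y) K `|y|.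
move=> /(_ _ lf _ K0 (normr_ge0 y) fK _ Aid) [||Af Afn].
- by move=> a u v; rewrite scalerDl scalerA.
- by move=> a; rewrite normrZ mulrC.
- by split => //; rewrite mulrC; move: Afn; rewrite nid mulr1.
Qed.

Lemma ideal_sum (E F : banach R) n (f : 'I_n -> E -> F) (k : 'I_n -> R) :
  (forall i, ideal_ops A (f i) /\ ideal_norm A (f i) <= k i) ->
  ideal_ops A (fun x => \sum_(i < n) f i x) /\
  ideal_norm A (fun x => \sum_(i < n) f i x) <= \sum_(i < n) k i.
Proof.
elim: n => [|n IHn] in f k * => fk.
  have := @ideal_rank_one E F (fun=> 0) 0 0 (lexx 0).
  rewrite normr0 mul0r big_ord0
    (_ : (fun x : E => \sum_(i < 0) f i x) = (fun=> 0)); last first.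
    by apply/funext => x; rewrite big_ord0.
  rewrite (_ : (fun x : E => 0 *: (0 : F)) = (fun=> 0)); last first.
    by apply/funext => x; rewrite scale0r.
  apply; split=> [a x y|x]; first by rewrite scaler0 addr0.
  by rewrite normr0 mul0r.
have [Af fle] := IHn _ _ (fun i => fk (widen_ord (leqnSn n) i)).
have [Ag gle] := fk ord_max; have [Afg fgle] := ideal_add Af Ag.
rewrite (_ : (fun x : E => \sum_(i < n.+1) f i x) =
  (fun x => \sum_(i < n) f (widen_ord (leqnSn n) i) x) \+ f ord_max); last first.
  by apply/funext => x; rewrite big_ord_recr.
by split => //; rewrite big_ord_recr /= (le_trans fgle) // lerD.
Qed.

Lemma ideal_finite_rank (M F : banach R) K n (b : 'I_n -> M) c (T : M -> F) :
  0 <= K -> coordinate_system K b c -> linear T ->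
  ideal_ops A T /\ ideal_norm A T <= \sum_(i < n) K * `|T (b i)|.
Proof.
move=> K0 [cK bc _] lT.
have := ideal_sum (fun i => ideal_rank_one (T (b i)) K0 (cK i)).
rewrite (_ : (fun x : M => _) = T) //.
by apply/funext => x; rewrite [in RHS](bc x) (linear_map_comb lT).
Qed.

(** The difference has finite rank, so its ideal norm is controlled by its values on the basis.
    Hence approximation at finitely many vectors is enough to compare ideal norms. *)
Lemma ideal_perturb (M F : banach R) K n (b : 'I_n -> M) c (S T : M -> F) e :
  0 <= K -> coordinate_system K b c -> linear S -> linear T -> ideal_ops A T ->
  (forall i, `|S (b i) - T (b i)| <= e) ->
  ideal_norm A S <= ideal_norm A T + n%:R * (K * e).
Proof.
move=> K0 bc lS lT AT STe.
have lD : linear (S \- T).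
  by move=> a x y /=; rewrite lS lT scalerBr opprD addrACA.
have [AD Dle] := ideal_finite_rank K0 bc lD.
have [_] := ideal_add AT AD.
rewrite (_ : T \+ (S \- T) = S); last by apply/funext => x /=; rewrite addrC subrK.
move=> /le_trans; apply; rewrite lerD2l (le_trans Dle) //.
rewrite mulr_natl -[X in _ *+ X]card_ord -sumr_const; apply: ler_sum => i _.
by rewrite ler_wpM2l //; exact: STe.
Qed.

End IdealBasics.

(* Two points receive the same code when all the functions agree on them up
   to [e]; the sample of a code is any point having that code. *)
Lemma finite_sampling (R : realType) (S : Type) n (w : 'I_n -> S -> R) (C e : R) :
  (exists s : S, True) -> (forall i s, `|w i s| <= C) -> 0 < e ->
  exists (J : finType) (code : S -> J) (sample : J -> S),
    forall i s, `|w i s - w i (sample (code s))| <= e.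
Proof.
move=> [s0 _] wC e0; pose h i s : R := (w i s + C) / e.
have h0 i s : 0 <= h i s.
  by rewrite divr_ge0 ?(ltW e0) //; have := wC i s; rewrite ler_norml; lra.
pose B := Num.truncn (2 * C / e).
have hB i s : (Num.truncn (h i s) <= B)%N.
  rewrite le_truncn // ler_pM2r ?invr_gt0 //.
  by have := wC i s; rewrite ler_norml; lra.
pose code s := [ffun i => inord (Num.truncn (h i s))] : {ffun 'I_n -> 'I_B.+1}.
have /choice[sample sampleP] (j : {ffun 'I_n -> 'I_B.+1}) :
    exists t, forall s, code s = j -> code t = j.
  have [[t tj]|nj] := pselect (exists t, code t = j); first by exists t.
  by exists s0 => s sj; case: nj; exists s.
exists {ffun 'I_n -> 'I_B.+1}, code, sample => i s.
have := sampleP _ _ (erefl (code s)); set t := sample _ => /ffunP/(_ i).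
rewrite !ffunE => /(congr1 (@nat_of_ord _)); rewrite !inordK ?ltnS // => ts.
have /andP[s1 s2] := truncn_itv (h0 i s); have /andP[t1 t2] := truncn_itv (h0 i t).
rewrite ts in t1 t2.
have : `|h i s - h i t| <= 1.
  by rewrite ler_norml; move: s1 s2 t1 t2; rewrite -natr1; lra.
rewrite /h -mulrBl normrM normfV (gtr0_norm e0) ler_pdivrMr // mul1r.
by rewrite opprD addrACA subrr addr0.
Qed.

(** * Averages over boxes *)

Section BoxAverages.
Context {R : realType} {V W : normedModType R}.
Implicit Types (l : seq (V * nat)) (phi psi : V -> W) (u v : V).

(** The box consists of the points [u + \sum v *+ j] with [j < m] for each entry [(v, m)]. Nesting
    the averages lets the sum along any one direction telescope. *)
Fixpoint box_avg l phi u : W :=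
  if l is (v, m) :: l' then m%:R^-1 *: \sum_(j < m) box_avg l' phi (u + v *+ j)
  else phi u.

Fixpoint in_box l (P : V -> Prop) u : Prop :=
  if l is (v, m) :: l' then forall j, (j < m)%N -> in_box l' P (u + v *+ j)
  else P u.

Definition pos_box l := all (fun vm : V * nat => 0 < vm.2)%N l.

Lemma in_boxW l (P Q : V -> Prop) u :
  (forall x, P x -> Q x) -> in_box l P u -> in_box l Q u.
Proof.
by move=> PQ; elim: l u => [|[v m] l IHl] u /=; [exact: PQ|move=> h j /h /IHl].
Qed.

Lemma box_avg_bound l phi c u : pos_box l ->
  in_box l (fun x => `|phi x| <= c) u -> `|box_avg l phi u| <= c.
Proof.
elim: l u => [|[v m] l IHl] u //= /andP[m0 pl] h.
have m0' : (0 : R) < m%:R by rewrite ltr0n.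
rewrite normrZ ger0_norm ?invr_ge0 ?ler0n // mulrC ler_pdivrMr //.
apply: le_trans (ler_norm_sum _ _ _) _.
rewrite mulr_natr -[X in _ *+ X]card_ord -sumr_const; apply: ler_sum => j _.
exact/IHl/h.
Qed.

Lemma box_avgB l phi psi u :
  box_avg l (fun x => phi x - psi x) u = box_avg l phi u - box_avg l psi u.
Proof.
elim: l u => [|[v m] l IHl] u //=; rewrite -scalerBr -sumrB; congr (_ *: _).
by apply: eq_bigr => j _.
Qed.

Lemma box_avg_cst l (c : W) u : pos_box l -> box_avg l (fun=> c) u = c.
Proof.
elim: l u => [|[v m] l IHl] u //= /andP[m0 pl].
under eq_bigr do rewrite IHl //.
by rewrite sumr_const card_ord -(scaler_nat m c) scalerA mulVf ?scale1r // pnatr_eq0 -lt0n.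
Qed.

Lemma box_avg_shift l phi w u : box_avg l (fun x => phi (x + w)) u = box_avg l phi (u + w).
Proof.
elim: l u => [|[v m] l IHl] u //=; congr (_ *: _).
by apply: eq_bigr => j _; rewrite IHl addrAC.
Qed.

Lemma box_avg_cat l1 l2 phi u : box_avg (l1 ++ l2) phi u = box_avg l1 (box_avg l2 phi) u.
Proof.
elim: l1 u => [|[v m] l IHl] u //=; congr (_ *: _).
by apply: eq_bigr => j _.
Qed.

(** Here [l'] is [l] without the entry [(v, m)], and two opposite faces remain. The far one, at
    [u + v *+ m], lies one step outside the box, whose last layer is at [m.-1]; the box translated
    by [v] reaches it. *)
Lemma box_avg_telescope l v m : pos_box l -> (v, m) \in l ->
  exists l', [/\ pos_box l',
    forall phi u, box_avg l (fun x => phi (x + v) - phi x) u =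
      m%:R^-1 *: (box_avg l' phi (u + v *+ m) - box_avg l' phi u) &
    forall P u, in_box l P u -> in_box l' P u /\ in_box l' P (u + v *+ m.-1)].
Proof.
elim: l => [|[v' m'] l IHl] //= /andP[m'0 pl]; rewrite inE => /orP[/eqP[-> ->]|/(IHl pl)].
  exists l; split => // [phi u|P u h]; last first.
    by rewrite -[X in in_box l P X](addr0 u) -(mulr0n v'); split; apply: h; rewrite ?prednK.
  congr (_ *: _).
  under eq_bigr do rewrite box_avgB box_avg_shift -addrA -mulrSr.
  rewrite -(big_mkord predT 
    (fun j => box_avg l phi (u + v' *+ j.+1) - box_avg l phi (u + v' *+ j))).
  by rewrite (telescope_sumr (fun j => box_avg l phi (u + v' *+ j))) // mulr0n addr0.
move=> [l' [pl' tel inb]]; exists ((v', m') :: l'); split.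
- by rewrite /= m'0.
- move=> phi u /=; under eq_bigr do rewrite tel.
  rewrite -scaler_sumr sumrB scalerA mulrC -scalerA; congr (_ *: _).
  rewrite scalerBr; congr (_ *: _ - _); apply: eq_bigr => j _.
  by rewrite addrAC.
- move=> P u /= h; split=> j jm; first exact: (inb _ _ (h j jm)).1.
  by rewrite addrAC; exact: (inb _ _ (h j jm)).2.
Qed.

(** Two boxes that differ by one step share all layers but two, each of weight [m%:R^-1]. *)
Lemma box_avg_step l v m phi c u : pos_box l -> (v, m) \in l ->
  in_box l (fun x => `|phi x| <= c) u ->
  in_box l (fun x => `|phi x| <= c) (u + v) ->
  `|box_avg l phi (u + v) - box_avg l phi u| <= 2 * c / m%:R.
Proof.
move=> pl vl h1 h2; have [l' [pl' tel inb]] := box_avg_telescope pl vl.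
have m0 : (0 < m)%N by move/allP: pl => /(_ _ vl).
rewrite -box_avg_shift -box_avgB tel normrZ ger0_norm ?invr_ge0 ?ler0n //.
rewrite mulrC ler_wpM2r ?invr_ge0 ?ler0n //.
apply: le_trans (ler_normB _ _) _; rewrite mulr2n mulrDl mul1r lerD //.
  apply: box_avg_bound => //; have [_] := inb _ _ h2.
  by rewrite -addrA -mulrS prednK.
by apply: box_avg_bound => //; have [] := inb _ _ h1.
Qed.

End BoxAverages.

Lemma box_avg_linear (R : realType) (V W W' : normedModType R) (T : W -> W')
    (l : seq (V * nat)) (phi : V -> W) u :
  linear T -> T (box_avg l phi u) = box_avg l (T \o phi) u.
Proof.
move=> lT; elim: l u => [|[v m] l IHl] u //=.
rewrite (linear_mapZ lT) (linear_map_sum lT); congr (_ *: _).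
by apply: eq_bigr => j _.
Qed.

(** * Grids and averaged increments *)

Section Grid.
Context {R : realType} {V : normedModType R} {I : finType} (E : I -> V).

(** Finitely many points, listed by short sequences: on such a set a Gateaux derivative gives
    uniform control. The coefficients are nonnegative, so integral combinations are treated as
    differences of two grid points. *)
Definition grid (Q : nat) (x : V) : Prop :=
  exists2 s : seq I, (size s <= Q)%N & x = \sum_(i <- s) E i.

Definition grid_box (m : I -> nat) (r : seq I) := [seq (E i, m i) | i <- r].

Lemma grid0 Q : grid Q 0.
Proof. by exists [::]; rewrite ?big_nil. Qed.

Lemma gridW Q Q' x : (Q <= Q')%N -> grid Q x -> grid Q' x.
Proof. by move=> QQ [s sQ ->]; exists s => //; exact: leq_trans QQ. Qed.

Lemma gridD Q Q' x y : grid Q x -> grid Q' y -> grid (Q + Q') (x + y).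
Proof.
move=> [s sQ ->] [s' sQ' ->]; exists (s ++ s'); last by rewrite big_cat.
by rewrite size_cat leq_add.
Qed.

Lemma grid_mulrn j i : grid j (E i *+ j).
Proof.
exists (nseq j i); first by rewrite size_nseq.
by rewrite big_nseq; elim: j => //= j <-; rewrite mulrS.
Qed.

Lemma in_grid_box m r Q u : grid Q u ->
  in_box (grid_box m r) (grid (Q + \sum_(i <- r) m i)) u.
Proof.
elim: r Q u => [|i r IHr] Q u Qu /=; first by rewrite big_nil addn0.
move=> j jm; rewrite big_cons addnA; apply: IHr.
by apply: gridD => //; apply: gridW (ltnW jm) (grid_mulrn _ _).
Qed.

End Grid.

Lemma seq_of_multiplicities (I : finType) (p : I -> nat) :
  exists2 s : seq I, size s = (\sum_i p i)%N &
    forall (V : zmodType) (E : I -> V), \sum_(i <- s) E i = \sum_i E i *+ p i.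
Proof.
exists (flatten [seq nseq (p i) i | i <- index_enum I]).
  rewrite size_flatten /shape -map_comp sumnE big_map.
  by apply: eq_bigr => i _; rewrite /= size_nseq.
move=> V E; rewrite big_flatten big_map; apply: eq_bigr => i _.
by rewrite big_nseq; elim: (p i) => //= j ->; rewrite mulrS.
Qed.

Lemma approx_nat_diff (R : realType) (x : R) (C : R) : `|x| <= C ->
  exists p n : nat, [/\ (p <= Num.truncn C)%N, (n <= Num.truncn C)%N &
    `|x - (p%:R - n%:R)| <= 1].
Proof.
move=> xC; have /andP[t1 t2] := truncn_itv (normr_ge0 x).
have tC : (Num.truncn `|x| <= Num.truncn C)%N by rewrite le_truncn.
move: t2; rewrite -natr1 => t2.
have [x0|x0] := leP 0 x; [exists (Num.truncn `|x|), 0%N|exists 0%N, (Num.truncn `|x|)].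
  by split => //; move: t1 t2; rewrite ger0_norm // ler_norml; lra.
by split => //; move: t1 t2; rewrite ltr0_norm // ler_norml; lra.
Qed.

Section BoxIncrement.
Context {R : realType} {V W : normedModType R} {I : finType} (E : I -> V).
Context (m : I -> nat) (r : seq I) (g : V -> W).

(** A discrete substitute for the derivative of [g] along [E i]. Its dependence on the direction is
    additive up to an error that decreases with the sides of the box. *)
Definition box_increment (i : I) : W :=
  box_avg (grid_box E m r) (fun x => g (x + E i) - g x) 0.

Context (m0 N : nat) (b : R).
(** Room for the box, for [N.+1] steps away from it and for one more step [E i]. *)
Let Q := (\sum_(i <- r) m i + N.+2)%N.
Hypothesis (b_ge0 : 0 <= b) (m0_gt0 : (0 < m0)%N) (m0_le : forall i, (m0 <= m i)%N).
Hypothesis (r_full : forall i, i \in r) (E_le : forall i, `|E i| <= b).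
Hypothesis g_lip : forall x y, grid E Q x -> grid E Q y -> `|g x - g y| <= `|x - y|.

Let l := grid_box E m r.
Let F x := box_avg l g x.

Let pl : pos_box l.
Proof.
by apply/allP => _ /mapP[i _ ->] /=; apply: leq_trans (m0_le i).
Qed.

Let sumE (s : seq I) := \sum_(i <- s) E i.

Let in_grid k x : (k <= N.+1)%N -> grid E k x ->
  in_box l (fun y => grid E Q y /\ forall i, grid E Q (y + E i)) x.
Proof.
move=> kN kx; apply: in_boxW (in_grid_box m r kx) => y yk; split.
  by apply: gridW yk; rewrite /Q; lia.
move=> i; apply: gridW (gridD yk (grid_mulrn E 1 i)); rewrite /Q; lia.
Qed.

Lemma box_increment_le i : `|box_increment i| <= `|E i|.
Proof.
apply: box_avg_bound => //; apply: in_boxW (in_grid (leq0n _) (grid0 E 0)) => y [y1 y2].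
by apply: le_trans (g_lip (y2 i) y1) _; rewrite addrAC subrr add0r.
Qed.

(** Each entry [k] of [s] translates the box by [E k], which costs at most [2 * b / m0%:R] by
    [box_avg_step]. *)
Let increment_stable i s : (size s <= N)%N ->
  `|box_avg l (fun x => g (x + E i) - g x) (sumE s) - box_increment i|
    <= (size s)%:R * (2 * b / m0%:R).
Proof.
elim: s => [|k s IHs] sN.
  by rewrite /sumE big_nil subrr normr0 mul0r.
rewrite [sumE _](_ : _ = sumE s + E k); last by rewrite /sumE big_cons addrC.
set f := fun x => _.
rewrite -(subrKA (box_avg l f (sumE s))) (le_trans (ler_normD _ _)) //=.
rewrite mulrSr mulrDl mul1r addrC lerD ?IHs //; first by apply: ltnW.
have gs k' x : (k' <= N.+1)%N -> grid E k' x -> in_box l (fun y => `|f y| <= b) x.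
  move=> kN kx; apply: in_boxW (in_grid kN kx) => y [y1 y2].
  apply: le_trans (g_lip (y2 i) y1) _; rewrite addrAC subrr add0r; exact: E_le.
have sg : grid E (size s) (sumE s) by exists s.
apply: le_trans (box_avg_step (v := E k) (m := m k) pl _
  (gs _ _ _ sg) (gs (size s).+1 _ _ _)) _.
- by apply/mapP; exists k.
- by move: sN => /=; lia.
- by move: sN => /=; lia.
- by rewrite -addn1; apply: gridD sg (grid_mulrn E 1 k).
rewrite ler_wpM2l ?mulr_ge0  // lef_pV2 ?posrE ?ltr0n ?ler_nat //.
exact: leq_trans (m0_le k).
Qed.

(** Along [s] the average [F] changes by one averaged increment per step. Comparing each of them
    with the one at 0 costs at most [size s] translations, hence the square. *)
Let increment_sum s : (size s <= N)%N ->
  `|F (sumE s) - F 0 - \sum_(i <- s) box_increment i|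
    <= (size s)%:R ^+ 2 * (2 * b / m0%:R).
Proof.
elim: s => [|k s IHs] sN.
  by rewrite /sumE !big_nil !subrr normr0 /= mulr0n expr0n mul0r.
rewrite [sumE _](_ : _ = sumE s + E k); last by rewrite /sumE big_cons addrC.
rewrite big_cons.
have sN' : (size s <= N)%N by exact: ltnW.
have h1 := increment_stable k sN'; have h2 := IHs sN'.
rewrite box_avgB box_avg_shift in h1.
rewrite [X in `|X|](_ : _ = (F (sumE s) - F 0 - \sum_(j <- s) box_increment j) +
  (F (sumE s + E k) - F (sumE s) - box_increment k)); last first.
  by rewrite [RHS]addrC addrACA -opprD subrKA.
apply: le_trans (ler_normD _ _) _; apply: le_trans (lerD h2 h1) _.
rewrite -mulrDl ler_wpM2r ?divr_ge0 ?mulr_ge0  //= mulrSr.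
by have := ler0n R (size s); lra.
Qed.

Lemma box_increment_comb (p n : I -> nat) :
  (\sum_i p i <= N)%N -> (\sum_i n i <= N)%N ->
  `|\sum_i ((p i)%:R - (n i)%:R) *: box_increment i| <=
  `|\sum_i ((p i)%:R - (n i)%:R) *: E i| + N%:R ^+ 2 * (4 * b / m0%:R).
Proof.
move=> pN nN; have [s sz sE] := seq_of_multiplicities p.
have [t tz tE] := seq_of_multiplicities n.
rewrite -sz in pN; rewrite -tz in nN.
have comb (X : lmodType R) (G : I -> X) :
    \sum_i ((p i)%:R - (n i)%:R) *: G i = \sum_(i <- s) G i - \sum_(i <- t) G i.
  rewrite sE tE -sumrB; apply: eq_bigr => i _.
  by rewrite scalerBl !scaler_nat.
rewrite !comb -/(sumE s) -/(sumE t).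
have hs := increment_sum pN; have ht := increment_sum nN.
(* [F] is an average of translates of [g], hence nonexpansive at the points concerned. *)
have Fst : `|F (sumE s) - F (sumE t)| <= `|sumE s - sumE t|.
  have FE w : F w = box_avg l (fun x => g (x + w)) 0 by rewrite box_avg_shift add0r.
  rewrite !FE -box_avgB.
  apply: box_avg_bound => //.
  apply: in_boxW (in_grid_box m r (grid0 E 0)) => y; rewrite add0n => yg.
  have -> : sumE s - sumE t = (y + sumE s) - (y + sumE t) by rewrite opprD addrACA subrr add0r.
  apply: g_lip.
    by apply: gridW (gridD yg _); last (by exists s); rewrite /Q; lia.
  by apply: gridW (gridD yg _); last (by exists t); rewrite /Q; lia.
set Ls := \sum_(i <- s) _ in hs *; set Lt := \sum_(i <- t) _ in ht *.
have -> : Ls - Lt = (F (sumE s) - F (sumE t)) - (F (sumE s) - F 0 - Ls) +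
    (F (sumE t) - F 0 - Lt).
  rewrite !opprD !opprK [_ + (_ + Ls)]addrA [RHS]addrACA [_ - _ + (_ + _)]addrACA subrr add0r.
  by rewrite [_ + F 0]addrC -[F 0 - _]opprB addNr add0r.
have bnd k : (k <= N)%N ->
    k%:R ^+ 2 * (2 * b / m0%:R) <= N%:R ^+ 2 * (2 * b / m0%:R).
  move=> kN; rewrite ler_wpM2r ?divr_ge0 ?mulr_ge0  //.
  by rewrite ler_sqr ?nnegrE ?ler0n // ler_nat.
apply: le_trans (ler_normD _ _) _; apply: le_trans (lerD (ler_normB _ _) (lexx _)) _.
have := bnd _ pN; have := bnd _ nN; move: hs ht Fst; lra.
Qed.

End BoxIncrement.

(* Rounding [H * x] to integer coefficients turns the comparison of integral
   combinations above into one for real coefficients. *)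
Lemma box_increment_real (R : realType) (q : nat) (b X eps : R) :
  0 <= b -> 0 <= X -> 0 < eps -> exists m0 N : nat, (0 < m0)%N /\
  forall (V W : normedModType R) (I : finType) (E : I -> V) (m : I -> nat)
    (r : seq I) (g : V -> W),
    #|I| = q -> (forall i, m0 <= m i)%N -> (forall i, i \in r) ->
    (forall i, `|E i| <= b) ->
    (forall x y, grid E (\sum_(i <- r) m i + N) x ->
       grid E (\sum_(i <- r) m i + N) y -> `|g x - g y| <= `|x - y|) ->
    forall x : I -> R, (forall i, `|x i| <= X) ->
      `|\sum_i x i *: box_increment E m r g i| <= `|\sum_i x i *: E i| + eps.
Proof.
move=> b0 X0 eps0.
(* The numbers [H * x i] are rounded: errors of at most [q * b] on both sides together cost
   [eps / 2] after division by [H]. The side [m0], chosen after [N], makes the averaging error cost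
   at most the other half. *)
pose H := (Num.truncn (4 * q%:R * b / eps)).+1.
have H0 : (0 : R) < H%:R by rewrite ltr0n.
have H1 : (1 : R) <= H%:R by rewrite ler1n.
have Hq : 2 * (q%:R * b) <= H%:R * (eps / 2).
  have := truncnS_gt (4 * q%:R * b / eps); rewrite -/H ltr_pdivrMr //.
  by lra.
pose P := Num.truncn (H%:R * X); pose N := (q * P)%N.
pose m0 := (Num.truncn (8 * N%:R ^+ 2 * b / eps)).+1.
have m00 : (0 : R) < m0%:R by rewrite ltr0n.
have Nm : N%:R ^+ 2 * (4 * b / m0%:R) <= H%:R * (eps / 2).
  apply: (@le_trans _ _ (eps / 2)); last by rewrite ler_peMl // ltW // divr_gt0.
  have := truncnS_gt (8 * N%:R ^+ 2 * b / eps); rewrite -/m0 ltr_pdivrMr // => h.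
  by rewrite mulrA ler_pdivrMr //; lra.
exists m0, N.+2; split => // V W I E m r g Iq m0m rf Eb glip x xX.
have /choice[pn pnP] : forall i, exists pn : nat * nat,
    [/\ (pn.1 <= P)%N, (pn.2 <= P)%N & `|H%:R * x i - (pn.1%:R - pn.2%:R)| <= 1].
  move=> i; have [|p [n [pP nP pn]]] := @approx_nat_diff _ (H%:R * x i) (H%:R * X).
    by rewrite normrM ger0_norm ?ler_wpM2l // ltW.
  by exists (p, n).
have sumP (p : I -> nat) : (forall i, p i <= P)%N -> (\sum_i p i <= N)%N.
  move=> pP; rewrite /N -Iq -sum_nat_const; exact: leq_sum.
have p1 : (\sum_i (pn i).1 <= N)%N by apply: sumP => i; have [] := pnP i.
have p2 : (\sum_i (pn i).2 <= N)%N by apply: sumP => i; have [] := pnP i.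
have := box_increment_comb b0 (isT : (0 < m0)%N) m0m rf Eb glip p1 p2.
set L := box_increment _ _ _ _.
pose d i : R := (pn i).1%:R - (pn i).2%:R; rewrite -/(d _) => h.
have near_d (Z : normedModType R) (G : I -> Z) : (forall i, `|G i| <= b) ->
    `|H%:R *: (\sum_i x i *: G i) - \sum_i d i *: G i| <= q%:R * b.
  move=> Gb; rewrite scaler_sumr -sumrB; apply: le_trans (ler_norm_sum _ _ _) _.
  rewrite mulr_natl -Iq -sumr_const; apply: ler_sum => i _.
  rewrite scalerA -scalerBl normrZ -[leRHS]mul1r ler_pM //.
  by have [] := pnP i.
have LE i : `|L i| <= b.
  by apply: le_trans (Eb i); exact: (box_increment_le b0 (isT : (0 < m0)%N) m0m glip).
have := near_d _ _ LE; have := near_d _ _ Eb.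
have HZ (Z : normedModType R) (z : Z) : `|H%:R *: z| = H%:R * `|z|.
  by rewrite normrZ ger0_norm // ltW.
set u := \sum_i d i *: E i in h *; set v := \sum_i d i *: L i in h *.
set u' := \sum_i x i *: E i; set v' := \sum_i x i *: L i => hE hL.
have : `|u| <= `|u - H%:R *: u'| + `|H%:R *: u'|
  by rewrite -{1}(subrK (H%:R *: u') u) ler_normD.
have : `|H%:R *: v'| <= `|H%:R *: v' - v| + `|v| by rewrite -{1}(subrK v (_ *: v')) ler_normD.
rewrite distrC in hE; rewrite !HZ => hv hu.
rewrite -(ler_pM2l H0) mulrDr; move: hE hL h Hq Nm hv hu; lra.
Qed.

(** * Operators with prescribed values *)

(** A Farkas-type form of Hahn-Banach: the infimum of [p] over the fibres of [rho] is sublinear on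
    [V], and nonnegativity of [p] on the kernel of [rho] keeps it finite. *)
Lemma sublinear_lift (R : realType) (Z V : lmodType R) (rho : Z -> V) (p : Z -> R) :
  linear rho -> (forall v, exists z, rho z = v) -> sublinear p ->
  (forall z, rho z = 0 -> 0 <= p z) ->
  exists2 f : V -> R, linear (f : V -> R^o) & forall z, f (rho z) <= p z.
Proof.
move=> lrho srho sp p0; have [pD pZ] := sp.
pose q v := inf [set p z | z in [set z | rho z = v]].
have qle z v : rho z = v -> q v <= p z.
  move=> zv; apply: ge_inf; last by exists z.
  exists (- p (- z)) => _ [y /= yv <-].
  rewrite lerNl -subr_ge0 opprK addrC; apply: le_trans (pD _ _).
  by apply: p0; rewrite (linear_mapB lrho) yv zv subrr.
have le_qv v a : (forall z, rho z = v -> a <= p z) -> a <= q v.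
  move=> h; apply: lb_le_inf; first by have [z zv] := srho v; exists (p z), z.
  by move=> _ [z /= zv <-]; exact: h.
have sq : sublinear q.
  apply: sublinearW.
  - apply/eqP; rewrite eq_le; apply/andP; split; last exact: le_qv.
    by rewrite -(sublinear0 sp); apply: qle; rewrite (linear_map0 lrho).
  - move=> x y; rewrite -lerBlDr; apply: (le_qv) => u ux.
    rewrite lerBlDr -lerBlDl; apply: (le_qv) => v vy; rewrite lerBlDl.
    by apply: le_trans (pD _ _); apply: qle; rewrite (linear_mapD lrho) ux vy.
  - move=> a x a0; rewrite -ler_pdivrMl //; apply: (le_qv) => u ux.
    rewrite ler_pdivrMl // -(pZ _ _ (ltW a0)); apply: qle.
    by rewrite (linear_mapZ lrho) ux.
have [f lf fq] := hahn_banach sq; exists f => // z.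
by apply: le_trans (fq _) _; exact: qle.
Qed.

Definition norming_net (R : realType) (N : normedModType R) (delta : R) (J : finType)
    (Psi : J -> N -> R) :=
  (forall j, functional 1 (Psi j)) /\
  forall x, exists j, `|x| <= (1 + delta) * Psi j x.

Section NormingNet.
Context {R : realType} {N : normedModType R} {K : R} {d : nat}.
Context {nu : 'I_d -> N} {c : 'I_d -> N -> R}.
Hypothesis (K0 : 0 < K) (cs : coordinate_system K nu c).

Let norming_net_aux (delta : R) : 0 < delta ->
  exists (J : finType) (Psi : J -> N -> R), norming_net delta Psi.
Proof.
move=> delta0; have [cK cE _] := cs.
pose S := {f : N -> R | functional 1 f}.
pose w a (f : S) := sval f (nu a).
have wle a (f : S) : `|w a f| <= \sum_b `|nu b|.
  apply: le_trans ((svalP f).2 (nu a)) _; rewrite mul1r.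
  by rewrite (bigD1 a) //= lerDl sumr_ge0.
have S0 : exists f : S, True.
  have f0 : functional 1 (fun=> 0 : R) => //.
    by move=> V; split=> [u x y|x]; rewrite ?scaler0 ?addr0 // normr0 mul1r.
  by exists (exist _ _ (f0 N)).
(* A sample within [e] of [f] on the basis differs from [f] at [x] by at most [delta / (1 + delta)]
   times the norm of [x], and [1 - delta / (1 + delta)] is the inverse of [1 + delta]. *)
pose e := (delta / (1 + delta)) / (d%:R * K + 1).
have dK : 0 < d%:R * K + 1 by rewrite ltr_wpDl // mulr_ge0 // ltW.
have d1 : 0 < 1 + delta by lra.
have e0 : 0 < e by rewrite /e !divr_gt0.
have [J [code [sample smp]]] := finite_sampling S0 wle e0.
exists J, (fun j => sval (sample j)); split=> [j|x]; first exact: svalP.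
have [f [ff fx]] := norming_functional x ler01.
pose s := sample (code (exist _ f ff)); exists (code (exist _ f ff)); rewrite -/s.
have : `|f x - sval s x| <= e * (d%:R * K) * `|x|.
  rewrite (cE x) (linear_map_comb ff.1) (linear_map_comb (svalP s).1) -sumrB.
  rewrite -(cE x); apply: le_trans (ler_norm_sum _ _ _) _.
  rewrite -mulrA -mulrA mulrCA mulr_natl -[X in _ *+ X](card_ord d) -sumr_const.
  apply: ler_sum => a _; rewrite -scalerBr normrM mulrC ler_pM //; last exact: (cK a).2.
  exact: smp a (exist _ f ff).
rewrite fx mul1r => h.
have : e * (d%:R * K) <= delta / (1 + delta).
  by rewrite /e -mulrA ler_piMr ?divr_ge0 ?(ltW delta0) ?(ltW d1) //
    mulrC ler_pdivrMr // mul1r lerDl.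
move=> /(ler_wpM2r (normr_ge0 x)) /(le_trans h).
rewrite ler_norml => /andP[_]; rewrite lerBlDr.
have -> : delta / (1 + delta) = 1 - (1 + delta)^-1 by field; rewrite gt_eqF.
by rewrite mulrBl mul1r -lerBlDl opprB addrC subrK ler_pdivrMl.
Qed.

(** Adjoining the rescaled coordinate functionals [K^-1 * c b] gives the matrix [Psi j (nu a)] a
    one-sided inverse [k], which later makes [rho] surjective. *)
Lemma finite_norming_net (delta : R) : 0 < delta ->
  exists (J : finType) (Psi : J -> N -> R), norming_net delta Psi /\
    exists k : 'I_d -> J -> R, forall a b, \sum_j Psi j (nu a) * k b j = (a == b)%:R.
Proof.
move=> delta0; have [J [Psi [fPsi nPsi]]] := norming_net_aux delta0.
have [cK cE cu] := cs.
pose Psi' (j : J + 'I_d) x := match j with inl j => Psi j x | inr b => K^-1 * c b x end.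
exists (J + 'I_d)%type, Psi'; split; first split.
- case=> [j|b] /=; first exact: fPsi.
  split=> [a x y|x]; first by rewrite /= (cK b).1 mulrDr scalerAr.
  by rewrite normrM ger0_norm ?invr_ge0 ?(ltW K0) // mul1r ler_pdivrMl // (cK b).2.
- by move=> x; have [j xj] := nPsi x; exists (inl j).
exists (fun b j => match j with inl _ => 0 | inr b' => (b' == b)%:R * K end) => a b.
rewrite big_sumType /= big1 ?add0r; last by move=> j _; rewrite mulr0.
rewrite (bigD1 b) //= big1 ?addr0; last by move=> b' /negPf ->; rewrite mul0r mulr0.
by rewrite eqxx mul1r (coordinate_dual _ _ cs) mulrAC mulVf ?mul1r // gt_eqF.
Qed.

End NormingNet.

Section OperatorInterpolation.
Context {R : realType} {N : normedModType R} {K : R} {d : nat}.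
Context {nu : 'I_d -> N} {c : 'I_d -> N -> R}.
Hypothesis cs : coordinate_system K nu c.
Context {delta : R} {J : finType} {Psi : J -> N -> R}.
Hypothesis (delta0 : 0 < delta) (net : norming_net delta Psi).
Context {G : normedModType R} {n : nat} (x : 'I_n -> G) (s : 'I_n -> N) (eps : R).
Hypothesis eps0 : 0 <= eps.

Hypothesis k_dual : exists k : 'I_d -> J -> R,
  forall a b, \sum_j Psi j (nu a) * k b j = (a == b)%:R.

Let Z := ((J -> G) * ('I_n -> 'I_d -> R^o))%type.

(* An operator [B : G -> N] is encoded by the functional
   [z |-> sum_a c_a (B (z a))] on [G^d]; then [norm B <= 1] means that this
   functional is at most [norm y] at [fun a => psi (nu a) *: y] for all [psi] in
   the dual ball, and the [x i] are sent near the [s i] if it is close to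
   [c_a (s i)] at [x i] placed in the slot [a]. *)
Let rho (z : Z) : 'I_d -> G := fun a =>
  \sum_j Psi j (nu a) *: z.1 j + \sum_i (z.2 i a : R) *: x i.

(** The three terms bound what a functional may do on [rho z]: the norm allowed by each [Psi j], the
    value prescribed at [x i] in slot [a], and the tolerance [eps] for that value. *)
Let cost (z : Z) : R := \sum_j `|z.1 j| + \sum_i \sum_a (z.2 i a : R) * c a (s i) +
  eps * \sum_i \sum_a `|z.2 i a : R|.

Hypothesis dual : forall (y : J -> G) (phi : 'I_n -> 'I_d -> R),
  (forall a, \sum_j Psi j (nu a) *: y j + \sum_i phi i a *: x i = 0) ->
  0 <= \sum_j `|y j| + \sum_i \sum_a phi i a * c a (s i) +
       eps * \sum_i \sum_a `|phi i a|.

(** [dual] states that [cost] is nonnegative on the kernel of [rho], so [sublinear_lift] provides a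
    functional [f] with [f (rho z) <= cost z], and [B] is the operator with coordinates
    [f (slot a y)]. *)
Lemma operator_interpolation : exists B : G -> N,
  [/\ linear B, forall y, `|B y| <= (1 + delta) * `|y| &
      forall i a, `|c a (B (x i)) - c a (s i)| <= eps].
Proof.
have [cK cE cu] := cs; have [fPsi nPsi] := net; have [k kE] := k_dual.
have lrho : linear rho.
  move=> a u v; apply/funext => b; rewrite /rho /= !(addrfctE, scalrfctE).
  rewrite [in RHS]scalerDr [RHS]addrACA !scaler_sumr.
  rewrite -!big_split /=; congr (_ + _); apply: eq_bigr => j _.
    by rewrite scalerDr !scalerA mulrC.
  by rewrite scalerDl scalerA.
have srho v : exists z, rho z = v.
  exists (fun j => \sum_b k b j *: v b, fun _ _ => 0); apply/funext => a.
  rewrite /rho /= [X in _ + X]big1 ?addr0; last by move=> i _; rewrite scale0r.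
  under eq_bigr do rewrite scaler_sumr.
  rewrite exchange_big (bigD1 a) //= [X in _ + X]big1 ?addr0; last first.
    move=> b /negPf ba; under eq_bigr do rewrite scalerA.
    by rewrite -scaler_suml kE eq_sym ba scale0r.
  under eq_bigr do rewrite scalerA.
  by rewrite -scaler_suml kE eqxx scale1r.
have scost : sublinear cost.
  split=> [u v|a u a0].
    rewrite /cost /= !(addrfctE, scalrfctE) [leRHS]addrACA [X in _ <= X + _]addrACA -mulrDr.
    rewrite lerD ?ler_wpM2l // ?lerD //.
    - by rewrite -big_split /= ler_sum // => j _; exact: ler_normD.
    - rewrite -big_split /= ler_sum // => i _; rewrite -big_split /= ler_sum // => b _.
      by rewrite -mulrDl.
    - rewrite -big_split /= ler_sum // => i _; rewrite -big_split /= ler_sum // => b _.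
      exact: ler_normD.
  rewrite /cost /= !(addrfctE, scalrfctE) !mulrDr [a * (eps * _)]mulrCA.
  congr (_ + _ + eps * _); rewrite mulr_sumr.
  - by apply: eq_bigr => j _; rewrite normrZ ger0_norm.
  - apply: eq_bigr => i _; rewrite mulr_sumr; apply: eq_bigr => b _.
    by rewrite mulrA.
  - apply: eq_bigr => i _; rewrite mulr_sumr; apply: eq_bigr => b _.
    by rewrite normrM ger0_norm.
have [|f lf fle] := sublinear_lift lrho srho scost.
  move=> [y phi] h; apply: dual => a; exact: (congr1 (fun v => v a) h).
pose slot b y : 'I_d -> G := fun a => (a == b)%:R *: y.
have lslot b : linear (slot b).
  move=> a u v; apply/funext => b'; rewrite /slot !(addrfctE, scalrfctE).
  by rewrite scalerDr [in RHS]scalerA [a * _]mulrC -scalerA.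
pose B y := \sum_a f (slot a y) *: nu a.
have cB a y : c a (B y) = f (slot a y) by exact: cu.
exists B; split.
- move=> a u v; rewrite /B scaler_sumr -big_split /=; apply: eq_bigr => b _.
  by rewrite lslot lf scalerDl scalerA.
- move=> y; have [j Bj] := nPsi (B y); apply: le_trans Bj _.
  rewrite ler_wpM2l ?addr_ge0 ?(ltW delta0) //.
  rewrite (linear_map_comb (fPsi j).1).
  (* Testing with [y] at the single index [j] yields that [Psi j (B y)] is at most the norm of
     [y]. *)
  pose z : Z := (fun j' => (j' == j)%:R *: y, fun _ _ => 0).
  have := fle z; rewrite (_ : cost z = `|y|); last first.
    rewrite /cost /z /= (bigD1 j) //= eqxx scale1r big1 ?addr0; last first.
      by move=> j' /negPf ->; rewrite scale0r normr0.
    rewrite [X in _ + X + _]big1 ?addr0; last first.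
      by move=> i _; rewrite big1 // => a _; rewrite mul0r.
    rewrite [X in eps * X]big1 ?mulr0 ?addr0 // => i _.
    by rewrite big1 // => a _; rewrite normr0.
  apply: le_trans; rewrite le_eqVlt; apply/orP; left; apply/eqP.
  rewrite (_ : rho z = \sum_a Psi j (nu a) *: slot a y).
    by rewrite (linear_map_comb lf); apply: eq_bigr => a _; exact: mulrC.
  apply/funext => a; rewrite /rho /= [X in _ + X]big1 ?addr0; last first.
    by move=> i _; rewrite scale0r.
  rewrite (bigD1 j) //= eqxx scale1r big1 ?addr0; last first.
    by move=> j' /negPf ->; rewrite scale0r scaler0.
  rewrite fct_sumE (bigD1 a) //= big1 ?addr0.
    by rewrite scalrfctE /slot eqxx scale1r.
  move=> b ba; rewrite scalrfctE /slot eq_sym (negPf ba).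
  by rewrite scale0r scaler0.
move=> i a; rewrite cB.
(* [t = 1] and [t = -1] give the two sides of the estimate. *)
have key (t : R) : t * f (slot a (x i)) <= t * c a (s i) + eps * `|t|.
  pose z : Z := (fun=> 0, fun i' a' => ((i' == i) && (a' == a))%:R * t).
  have := fle z; rewrite (_ : cost z = t * c a (s i) + eps * `|t|); last first.
    rewrite /cost /z /= big1 ?add0r; last by move=> j _; rewrite normr0.
    congr (_ + eps * _); rewrite (bigD1 i) //= (bigD1 a) //= !eqxx mul1r.
      rewrite !big1 ?addr0 // => [i' /negPf i'i|a' /negPf ->].
        by rewrite big1 // => a' _; rewrite i'i mul0r mul0r.
      by rewrite andbF !mul0r.
    rewrite !big1 ?addr0 // => [i' /negPf i'i|a' /negPf ->].
      by rewrite big1 // => a' _; rewrite i'i mul0r normr0.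
    by rewrite andbF !mul0r normr0.
  rewrite (_ : rho z = t *: slot a (x i)) ?(linear_mapZ lf) //.
  apply/funext => b; rewrite /rho /= [X in X + _]big1 ?add0r; last first.
    by move=> j _; rewrite scaler0.
  rewrite (bigD1 i) //= big1 ?addr0; last by move=> i' /negPf ->; rewrite mul0r scale0r.
  by rewrite eqxx scalrfctE /slot /= scalerA mulrC.
have := key 1; have := key (-1); rewrite normrN normr1 mulr1 !mul1r !mulN1r.
by rewrite ler_norml; lra.
Qed.

End OperatorInterpolation.

Lemma in_box_norm (R : realType) (V : normedModType R) (l : seq (V * nat)) (u : V) :
  in_box l (fun x => `|x| <= `|u| + \sum_(vm <- l) `|vm.1| *+ vm.2) u.
Proof.
elim: l u => [|[v m] l IHl] u /=; first by rewrite big_nil addr0.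
move=> j jm; apply: in_boxW (IHl _) => x /le_trans; apply.
rewrite big_cons addrA lerD2r (le_trans (ler_normD _ _)) // lerD2l.
by rewrite normrMn /= ler_wpMn2l // ltnW.
Qed.

Lemma in_box_full (R : realType) (V : normedModType R) (l : seq (V * nat)) (P : V -> Prop) u :
  (forall x, P x) -> in_box l P u.
Proof. by move=> hP; elim: l u => [|[v m] l IHl] u //= j _; exact: IHl. Qed.

(* Far away from the origin the increment along [v] is still known, because its
   average over the long box telescopes. *)
Lemma box_avg_known_increment (R : realType) (V W : normedModType R)
    (l1 l2 : seq (V * nat)) (v : V) m (g : V -> W) (w : W) (rho eta : R) :
  pos_box l1 -> pos_box l2 -> (v, m) \in l2 ->
  (forall x y, `|g x - g y| <= `|x - y|) ->
  in_box l1 (fun x => `|x| <= rho) 0 ->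
  in_box l2 (fun x => `|g (x + v) - g x - w| <= eta) 0 ->
  `|box_avg (l1 ++ l2) (fun x => g (x + v) - g x) 0 - w| <= 2 * rho / m%:R + eta.
Proof.
move=> p1 p2 vm glip h1 h2; rewrite box_avg_cat.
rewrite -(box_avg_cst w 0 p1) -box_avgB; apply: box_avg_bound => //.
apply: in_boxW h1 => x xrho.
have [l' [pl' tel _]] := @box_avg_telescope _ _ W _ _ _ p2 vm.
set f := fun x => g (x + v) - g x.
rewrite -(subrKA (box_avg l2 f 0)) (le_trans (ler_normD _ _)) // lerD //; last first.
  by rewrite -[X in _ - X](box_avg_cst w 0 p2) -box_avgB box_avg_bound.
rewrite !tel -scalerBr normrZ ger0_norm ?invr_ge0 ?ler0n //.
rewrite mulrC ler_wpM2r ?invr_ge0 ?ler0n //.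
have stab y : `|box_avg l' g (x + y) - box_avg l' g y| <= rho.
  rewrite [x + y]addrC -box_avg_shift -box_avgB box_avg_bound //; apply: in_box_full => z.
  by apply: le_trans (glip _ _) _; rewrite addrAC subrr add0r.
rewrite add0r opprB [_ 0 - _]addrC addrACA (le_trans (ler_normD _ _)) //.
rewrite mulr2n mulrDl mul1r lerD ?stab //.
by rewrite addrC distrC; have := stab 0; rewrite addr0.
Qed.

(** * Linearizing a nonexpansive map into a finite-dimensional space *)

Section LocalLift.
Context {R : realType} {N : normedModType R} {K : R} {d : nat}.
Context {nu : 'I_d -> N} {c : 'I_d -> N -> R}.
Hypothesis (K0 : 0 < K) (cs : coordinate_system K nu c).

(* By [operator_interpolation] only finitely many auxiliary vectors [y j] matter,
   their number being fixed in advance. The increments of [g] are averaged over a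
   box that is short along the [y j] and much longer along the [x i], so that the
   averaged increment along [x i] remains close to [s i]. *)
Lemma local_lift (delta eps D : R) n (s : 'I_n -> N) :
  0 < delta -> 0 < eps -> 0 <= D ->
  exists Q : nat, exists2 eta : R, 0 < eta &
  forall (G : normedModType R) (x : 'I_n -> G) (g : G -> N),
    (forall u v, `|g u - g v| <= `|u - v|) -> (forall i, `|x i| <= D) ->
    (forall t : seq 'I_n, (size t <= Q)%N ->
       `|g (\sum_(i <- t) x i) - \sum_(i <- t) s i| <= eta) ->
    exists B : G -> N, [/\ linear B, forall y, `|B y| <= (1 + delta) * `|y| &
      forall i, `|B (x i) - s i| <= eps].
Proof.
move=> delta0 eps0 D0; have [cK cE cu] := cs.
have [J [Psi [net dualnet]]] := finite_norming_net K0 cs delta0.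
(* [Nn] bounds the coefficients [Psi j (nu a)] and [phi i a] of the relations below. An error
   [e = eps / Nn] in each coordinate amounts to at most [eps] in norm. *)
pose Nn := \sum_a `|nu a| + 1.
have nuN a : `|nu a| <= Nn.
  by rewrite /Nn (bigD1 a) //= -addrA lerDl addr_ge0 // sumr_ge0.
have Nn1 : 1 <= Nn by rewrite /Nn lerDr sumr_ge0.
have Nn0 : 0 < Nn by exact: lt_le_trans Nn1.
pose e := eps / Nn; have e0 : 0 < e by rewrite divr_gt0.
(* When [phi] has total mass 1, the prescribed values contribute at least [- Y], so the duality
   inequality is trivial as soon as the [y j] have total norm above [Y]. Only bounded [y] remain. *)
pose Y := \sum_i \sum_a `|c a (s i)|.
have Y0 : 0 <= Y by apply: sumr_ge0 => i _; apply: sumr_ge0.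
pose e1 := e / (2 * (d%:R * K + 1)).
have dK : 0 <= d%:R * K by rewrite mulr_ge0 // ltW.
have e10 : 0 < e1 by rewrite divr_gt0 // mulr_gt0 //; lra.
have e1P : d%:R * K * e1 <= e / 2.
  rewrite /e1 mulrA ler_pdivrMr ?mulr_gt0 //; last by lra.
  by have := mulr_ge0 dK (ltW e0); lra.
have [m0 [N0 [m00 incr]]] :=
  box_increment_real (#|J| + n) (addr_ge0 Y0 D0) (ltW Nn0) e10.
(* The box with sides [m0] along the [y j] stays within radius [rho]; the longer side [m] along the
   [x i] makes the error [2 * rho / m%:R] small. *)
pose rho := m0%:R * Y; have rho0 : 0 <= rho by rewrite mulr_ge0.
pose m := (m0 + (Num.truncn (8 * K * rho / e)).+1)%N.
have mP : K * (2 * rho / m%:R) <= e / 4.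
  have m0' : 0 < m%:R :> R by rewrite ltr0n /m addnS.
  rewrite mulrA ler_pdivrMr //.
  have := truncnS_gt (8 * K * rho / e); rewrite ltr_pdivrMr // => h.
  have : (Num.truncn (8 * K * rho / e)).+1%:R <= m%:R :> R by rewrite ler_nat leq_addl.
  by move=> /(ler_wpM2r (ltW e0)); lra.
pose eta := e / (8 * K); have eta0 : 0 < eta by rewrite divr_gt0 // mulr_gt0.
have etaP : K * (eta + eta) = e / 4.
  by rewrite /eta; field; rewrite gt_eqF.
(* A point of the long box is a sum of at most [n * m] of the [x i], and the increment adds one
   more. *)
exists (n * m).+1, eta => // G x g glip xD gs.
pose mm (j : J + 'I_n) := match j with inl _ => m0 | inr _ => m end.
pose r1 : seq (J + 'I_n) := map inl (index_enum J).
pose r2 : seq (J + 'I_n) := map inr (index_enum 'I_n).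
(* The relation [rel] passes, up to [e1], to the averaged increments [L] with values in [N].
   Applying [c a] to its component [a] and summing gives a trace: its first part is at most the
   total norm of the [y j], its second is close to the prescribed values. *)
have claim (y : J -> G) (phi : 'I_n -> 'I_d -> R) :
    (forall a, \sum_j Psi j (nu a) *: y j + \sum_i phi i a *: x i = 0) ->
    \sum_i \sum_a `|phi i a| = 1 -> \sum_j `|y j| <= Y ->
    0 <= \sum_j `|y j| + \sum_i \sum_a phi i a * c a (s i) + e.
  move=> rel phi1 yY.
  pose E (j : J + 'I_n) := match j with inl j => y j | inr i => x i end.
  pose L := box_increment E mm (r1 ++ r2) g.
  have Eb j : `|E j| <= Y + D.
    case: j => [j|i] /=; last by rewrite (le_trans (xD i)) // lerDr.
    apply: (@le_trans _ _ Y); last by rewrite lerDl.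
    by apply: le_trans yY; rewrite (bigD1 j) //= lerDl sumr_ge0.
  have mmP j : (m0 <= mm j)%N by case: j => //= i; rewrite leq_addr.
  have Ly j : `|L (inl j)| <= `|y j|.
    apply: (@box_increment_le _ _ _ _ E mm (r1 ++ r2) g m0 0 0 (lexx _) m00 mmP).
    by move=> u v _ _; exact: glip.
  have Lx i : `|L (inr i) - s i| <= 2 * rho / m%:R + (eta + eta).
    rewrite /L /box_increment /grid_box map_cat.
    have pos r : pos_box [seq (E j, mm j) | j <- r].
      by rewrite /pos_box all_map; apply/allP => j _ /=; exact: leq_trans (mmP j).
    apply: box_avg_known_increment => //.
    - by apply/mapP; exists (inr i) => //; rewrite map_f // mem_index_enum.
    - apply: in_boxW (in_box_norm _ _) => z /le_trans; apply.
      rewrite normr0 add0r /r1 !big_map /= sumrMnl -mulr_natl.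
      by rewrite ler_wpM2l.
    have -> : [seq (E j, mm j) | j <- r2] = grid_box x (fun=> m) (index_enum 'I_n).
      by rewrite /r2 -map_comp.
    apply: in_boxW (in_grid_box _ _ (grid0 x 0)) => _ [t tQ ->].
    rewrite add0n sum_nat_const card_ord in tQ.
    rewrite [X in `|X|](_ : _ = (g (\sum_(j <- i :: t) x j) - \sum_(j <- i :: t) s j) -
      (g (\sum_(j <- t) x j) - \sum_(j <- t) s j)); last first.
      by rewrite !big_cons [x i + _]addrC opprB opprD !addrA subrK addrAC.
    by rewrite (le_trans (ler_normB _ _)) // lerD // gs //= ltnW.
  have phi_le i a : `|phi i a| <= 1.
    rewrite -phi1 (bigD1 i) //= (bigD1 a) //= -addrA lerDl.
    by rewrite addr_ge0 ?sumr_ge0 // => i' _; rewrite sumr_ge0.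
  have comb a : `|\sum_j Psi j (nu a) *: L (inl j) + \sum_i phi i a *: L (inr i)| <= e1.
    pose co (k : J + 'I_n) := match k with inl j => Psi j (nu a) | inr i => phi i a end.
    have := incr _ _ _ E mm (r1 ++ r2) g _ mmP _ Eb _ co.
    rewrite !big_sumType /= rel normr0 add0r; apply.
    - by rewrite card_sum card_ord.
    - by case=> j; rewrite mem_cat /r1 /r2 map_f ?mem_index_enum ?orbT.
    - by move=> u v _ _; exact: glip.
    case=> [j|i] /=; last exact: le_trans (phi_le _ _) Nn1.
    by apply: le_trans ((net.1 j).2 _) _; rewrite mul1r.
  pose v a := \sum_j Psi j (nu a) *: L (inl j) + \sum_i phi i a *: L (inr i).
  have vle a : - (K * e1) <= c a (v a).
    have := (cK a).2 (v a); rewrite ler_norml => /andP[+ _]; apply: le_trans.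
    by rewrite lerN2; apply: ler_wpM2l; [exact: ltW|exact: comb].
  have : - (d%:R * K * e1) <= \sum_a c a (v a).
    rewrite -mulrA mulr_natl -mulNrn -[X in _ *+ X](card_ord d) -sumr_const.
    by apply: ler_sum.
  have -> : \sum_a c a (v a) =
      \sum_j Psi j (L (inl j)) + \sum_i \sum_a phi i a * c a (L (inr i)).
    under eq_bigr => a _ do
      rewrite (linear_mapD (cK a).1) !(linear_map_comb (cK a).1).
    rewrite big_split /= exchange_big [X in _ + X]exchange_big /=; congr (_ + _).
    apply: eq_bigr => j _; rewrite [in RHS](cE (L (inl j))) (linear_map_comb (net.1 j).1).
    by apply: eq_bigr => a _; exact: mulrC.
  have : \sum_j Psi j (L (inl j)) <= \sum_j `|y j|.
    apply: ler_sum => j _; apply: le_trans (Ly j); apply: le_trans (ler_norm _) _.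
    by have := (net.1 j).2 (L (inl j)); rewrite mul1r.
  have : \sum_i \sum_a phi i a * c a (L (inr i)) <=
      \sum_i \sum_a phi i a * c a (s i) + K * (2 * rho / m%:R + (eta + eta)).
    set C := K * _; rewrite -lerBlDl -sumrB -[leRHS]mul1r -phi1 mulr_suml.
    apply: ler_sum => i _.
    rewrite -sumrB mulr_suml; apply: ler_sum => a _.
    rewrite -mulrBr; apply: le_trans (ler_norm _) _; rewrite normrM ler_wpM2l //.
    have -> : c a (L (inr i)) - c a (s i) = c a (L (inr i) - s i).
      by rewrite (linear_mapB (cK a).1).
    by apply: le_trans ((cK a).2 _) _; apply: ler_wpM2l; [exact: ltW|exact: Lx].
  by move: e1P mP etaP; rewrite mulrDr; lra.
have [|B [lB Bn Be]] :=
  operator_interpolation cs delta0 net (x := x) (s := s) (ltW e0) dualnet.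
  move=> y phi rel; pose t := \sum_i \sum_a `|phi i a|.
  have t0 : 0 <= t by apply: sumr_ge0 => i _; apply: sumr_ge0.
  have S0 : 0 <= \sum_j `|y j| by apply: sumr_ge0.
  rewrite -/t; have [tz|tn] := eqVneq t 0.
    rewrite tz mulr0 addr0 [X in _ + X]big1 ?addr0 // => i _; rewrite big1 // => a _.
    suff /eqP : phi i a == 0 by move=> ->; rewrite mul0r.
    rewrite -normr_le0 -tz /t (bigD1 i) //= (bigD1 a) //= -addrA lerDl.
    by rewrite addr_ge0 ?sumr_ge0 // => i' _; rewrite sumr_ge0.
  have tp : 0 < t by rewrite lt_def tn.
  have phiE : \sum_i \sum_a `|t^-1 * phi i a| = 1.
    under eq_bigr => i _.
      under eq_bigr => a _ do rewrite normrM ger0_norm ?invr_ge0 //.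
      rewrite -mulr_sumr; over.
    by rewrite -mulr_sumr mulVf.
  have yE : \sum_j `|t^-1 *: y j| = t^-1 * \sum_j `|y j|.
    by rewrite mulr_sumr; apply: eq_bigr => j _; rewrite normrZ ger0_norm ?invr_ge0.
  have fE : \sum_i \sum_a t^-1 * phi i a * c a (s i) =
      t^-1 * \sum_i \sum_a phi i a * c a (s i).
    rewrite mulr_sumr; apply: eq_bigr => i _; rewrite mulr_sumr; apply: eq_bigr => a _.
    by rewrite mulrA.
  rewrite -(pmulr_rge0 _ (_ : 0 < t^-1)) ?invr_gt0 // !mulrDr -yE -fE.
  rewrite [t^-1 * _]mulrCA mulVf // mulr1.
  have [yY|yY] := leP (\sum_j `|t^-1 *: y j|) Y.
    apply: claim => // a; have := congr1 (fun z => t^-1 *: z) (rel a).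
    rewrite scaler0 scalerDr !scaler_sumr; apply: etrans.
    congr (_ + _); apply: eq_bigr => j _; rewrite !scalerA //.
    by rewrite mulrC.
  have : - Y <= \sum_i \sum_a t^-1 * phi i a * c a (s i).
    rewrite lerNl; apply: le_trans (ler_norm _) _; rewrite normrN.
    apply: le_trans (ler_norm_sum _ _ _) _; apply: ler_sum => i _.
    apply: le_trans (ler_norm_sum _ _ _) _; apply: ler_sum => a _.
    rewrite normrM ler_piMl // -phiE (bigD1 i) //= (bigD1 a) //= -addrA lerDl.
    by rewrite addr_ge0 ?sumr_ge0 // => i' _; rewrite sumr_ge0.
  by move: yY (ltW e0); lra.
exists B; split=> // i; rewrite [X in `|X|]cE; apply: le_trans (ler_norm_sum _ _ _) _.
apply: (@le_trans _ _ (e * \sum_a `|nu a|)).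
  rewrite mulr_sumr; apply: ler_sum => a _; rewrite normrZ ler_wpM2r //.
  by rewrite (linear_mapB (cK a).1) Be.
by rewrite /e mulrAC ler_pdivrMr // ler_wpM2l ?(ltW eps0) // lerDl.
Qed.

End LocalLift.

(** * Ultraproducts *)

Lemma quot_map_linear (R : realType) (F : normedModType R) (L : closed_subspace F) :
  linear (@quot_map R F L).
Proof. by move=> a x y; rewrite quot_mapD quot_mapZ. Qed.

Lemma quot_map_le (R : realType) (F : normedModType R) (L : closed_subspace F) (x : F) :
  `|quot_map L x| <= `|x|.
Proof.
rewrite quot_normE; apply: ge_inf; last by exists x.
by exists 0 => _ [y _ <-].
Qed.

(* Compose with a norming functional of [T x] and with [a |-> a *: x]: this gives
   a multiple of the identity of the scalar field. *)
Lemma op_le_ideal_norm (R : realType) (A : banach_ideal R) (E F : banach R) (T : E -> F) x :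
  ideal_ops A T -> `|T x| <= ideal_norm A T * `|x|.
Proof.
move=> AT; have [lT _] := ideal_bounded AT.
have [f [[lf fle] fx]] := norming_functional (T x) ler01.
pose U (a : R^o) : E := (a : R) *: x.
have lU : linear U by move=> a u v; rewrite /U scalerDl scalerA.
have Ule a : `|U a| <= `|x| * `|a| by rewrite normrZ mulrC.
have := ideal_comp_le (F0 := R^o) lU lf (normr_ge0 x) ler01 Ule fle AT.
set S := (S in ideal_ops A S) => -[AS Sle].
have SE (a : R^o) : S a = (a : R) * `|T x|.
  by rewrite /S /= (linear_mapZ lT) (linear_mapZ lf) fx mul1r.
have [->|Tx] := eqVneq (`|T x|) 0; first by rewrite mulr_ge0 ?ideal_norm_ge0.
have Tx0 : 0 < `|T x| by rewrite lt_def Tx /=.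
have [_ nid] := ideal_id A.
have lid : linear (idfun : R^o -> R^o) by [].
have lV : linear (fun a : R^o => `|T x|^-1 *: a : R^o).
  by move=> a u v; rewrite scalerDr !scalerA mulrC.
have := ideal_comp_le lid lV ler01 (_ : 0 <= `|T x|^-1) _ _ AS.
move=> []; rewrite ?invr_ge0 ?(ltW Tx0) //.
- by move=> a; rewrite mul1r.
- by move=> a; rewrite normrZ ger0_norm ?invr_ge0 ?(ltW Tx0).
move=> _; rewrite (_ : _ \o _ = idfun) ?nid; last first.
  by apply/funext => a /=; rewrite SE -[_ *: _]/(_ * _) mulrCA mulVf // mulr1.
rewrite mulr1 ler_pdivlMl // mulr1 => /le_trans; apply.
by rewrite mul1r in Sle.
Qed.

Section UltraImage.
Context {R : realType} {I : Type} (U : set_system I) {UU : UltraFilter U}.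
Context {G1 G2 : I -> banach R} (T : forall k, G1 k -> G2 k).
Context (A : banach_ideal R) (C D : R).
Hypothesis (D1 : 1 <= D) (CD : C <= D).
Hypothesis AT : forall k, ideal_ops A (@T k) /\ ideal_norm A (@T k) <= C.

(** The bound is [D] on the spaces [G1 k] and 1 on the [G2 k]: a norm-one functional composed with
    [T k] has norm at most [C <= D]. As [1 <= D], the larger families still norm [G1 k]. *)
Definition functional_family (G : I -> banach R) (c : R) :=
  {gam : forall k, G k -> R | forall k, functional c (gam k)}.

Let Gam1 := functional_family G1 D.
Let Gam2 := functional_family G2 1.

(* [bounded_banach Gam1] contains the ultraproduct of the [G1 k] (up to the
   factor [D]), a family [v] being sent to [gam |-> lim_U (gam k (v k))]; this
   is the closure of its image. *)
Definition ultra_approx (w : bounded_banach (R := R) Gam1) (e : R) (v : forall k, G1 k) :=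
  (exists c : R, forall k, `|v k| <= c) /\
  forall gam : Gam1, \forall k \near U,
    `|bval w gam - sval gam k (v k)| <= e.

Definition ultra_set : set (bounded_banach (R := R) Gam1) :=
  [set w | forall e : R, 0 < e -> exists v, ultra_approx w e v].

Let ultra_set0 : ultra_set 0.
Proof.
move=> e e0; exists (fun=> 0); split; first by exists 0 => k; rewrite normr0.
move=> gam; apply: nearW => k.
by rewrite (linear_map0 (svalP gam k).1) (linear_map0 (bval_linear gam)) subr0 normr0 ltW.
Qed.

Let ultra_setP (a : R) x y : ultra_set x -> ultra_set y -> ultra_set (a *: x + y).
Proof.
move=> Ux Uy e e0.
have a0 : 0 < `|a| + 1 by rewrite ltr_wpDl.
have ea0 : 0 < e / (2 * (`|a| + 1)) by rewrite divr_gt0 // mulr_gt0.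
have e20 : 0 < e / 2 by rewrite divr_gt0.
have [u [[c uc] ux]] := Ux _ ea0; have [v [[d vd] vy]] := Uy _ e20.
exists (fun k => a *: u k + v k); split.
  exists (`|a| * c + d) => k; apply: le_trans (ler_normD _ _) _.
  by rewrite lerD ?vd // normrZ ler_wpM2l ?uc.
move=> gam; near=> k.
have hu : `|bval x gam - sval gam k (u k)| <= e / (2 * (`|a| + 1)) by near: k.
have hv : `|bval y gam - sval gam k (v k)| <= e / 2 by near: k.
rewrite (bval_linear gam).
rewrite (svalP gam k).1 opprD addrACA -scalerBr (splitr e).
apply: le_trans (ler_normD _ _) _; apply: lerD hv.
rewrite normrZ; apply: le_trans (ler_wpM2l (normr_ge0 a) hu) _.
rewrite mulrA ler_pdivrMr ?mulr_gt0 //.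
by have := normr_ge0 a; nra.
Unshelve. all: by end_near. Qed.

Definition ultra_subspace := Subspace ultra_set0 ultra_setP.

Lemma ultra_closed : closed (subspace_set ultra_subspace).
Proof.
move=> w /= wcl e e0; have e20 : 0 < e / 2 by rewrite divr_gt0.
have [|x [/= Ux]] := wcl (ball w (e / 2)); first exact: nbhsx_ballx.
rewrite -ball_normE /= => wx; have [v [vb vx]] := Ux _ e20.
exists v; split => // gam; near=> k.
have : `|bval x gam - sval gam k (v k)| <= e / 2 by near: k.
have : `|bval w gam - bval x gam| <= e / 2.
  by rewrite -(linear_mapB (bval_linear gam)) (le_trans (bval_le _ _)) // ltW.
rewrite -[X in _ -> _ -> `|X| <= _](subrKA (bval x gam)) => h1 h2.
by apply: le_trans (ler_normD _ _) _; rewrite (splitr e) lerD.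
Unshelve. all: by end_near. Qed.

Definition ultra_space : banach R := closed_subspace_banach (ClosedSubspace ultra_closed).

Lemma functional_comp_T (gam : Gam2) k : functional D (sval gam k \o @T k).
Proof.
have [ATk Tk] := AT k; have [lT _] := ideal_bounded ATk.
split; first exact: linear_comp (svalP gam k).1 lT.
move=> x /=; apply: le_trans ((svalP gam k).2 _) _; rewrite mul1r.
apply: le_trans (op_le_ideal_norm _ ATk) _; rewrite ler_wpM2r //.
exact: le_trans CD.
Qed.

Definition comp_T (gam : Gam2) : Gam1 := exist _ _ (functional_comp_T gam).

Definition ultra_eval (w : ultra_space) (gam : Gam1) : R := bval (closed_incl w) gam.

Lemma ultra_eval_le w gam : `|ultra_eval w gam| <= `|w|.
Proof. by rewrite -closed_incl_norm; exact: bval_le. Qed.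

Lemma ultra_eval_linear gam : linear (ultra_eval^~ gam : ultra_space -> R^o).
Proof. by move=> a x y; rewrite /ultra_eval closed_incl_linear bval_linear. Qed.

Lemma ultra_map_subproof (w : ultra_space) :
  exists c : R, forall gam, `|ultra_eval w (comp_T gam)| <= c.
Proof. by exists `|w| => gam; exact: ultra_eval_le. Qed.

(** If [w] represents a family [v], its image represents the family of the [T (v k)]. *)
Definition ultra_map (w : ultra_space) : bounded_banach (R := R) Gam2 :=
  mk_bval (ultra_map_subproof w).

Lemma ultra_map_linear : linear ultra_map.
Proof.
move=> a x y; apply: bval_ext => gam.
by rewrite bval_linear !bval_mk ultra_eval_linear.
Qed.

Lemma ultra_map_le w : `|ultra_map w| <= `|w|.
Proof. by apply: bval_norm_le => // gam; exact: ultra_eval_le. Qed.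

Lemma ultra_eval_approx (w : ultra_space) (e : R) : 0 < e ->
  exists v : forall k, G1 k, forall gam : Gam1, \forall k \near U,
    `|ultra_eval w gam - sval gam k (v k)| <= e.
Proof. by move=> /(closed_inclP w)[v [_ vw]]; exists v. Qed.

(* The norming functionals are chosen for coefficients [a] that violate the
   bound, if there are any, so that the exceptional set does not depend on [a]. *)
Lemma ultra_lift_le n (w : 'I_n -> ultra_space) (v : 'I_n -> forall k, G1 k) (e : R) :
  (forall i (gam : Gam1), \forall k \near U,
    `|ultra_eval (w i) gam - sval gam k (v i k)| <= e) ->
  \forall k \near U, forall a : 'I_n -> R,
    `|\sum_(i < n) a i *: v i k| <= `|\sum_(i < n) a i *: w i| + e * \sum_(i < n) `|a i|.
Proof.
move=> wv.
pose good k (a : 'I_n -> R) := `|\sum_(i < n) a i *: v i k| <=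
  `|\sum_(i < n) a i *: w i| + e * \sum_(i < n) `|a i|.
have /choice[a aP] k : exists a : 'I_n -> R, good k a -> forall b, good k b.
  have [allg|] := pselect (forall b, good k b); first by exists (fun=> 0).
  by move=> /existsNP[b nb]; exists b.
have D0 : 0 <= D by exact: le_trans D1.
pose gamE k := cid (norming_functional (\sum_(i < n) a k i *: v i k) D0).
pose gam k := projT1 (gamE k).
have gamP k : functional D (gam k) /\
    gam k (\sum_(i < n) a k i *: v i k) = D * `|\sum_(i < n) a k i *: v i k|.
  exact: projT2 (gamE k).
pose gam' : Gam1 := exist _ gam (fun k => (gamP k).1).
have : \forall k \near U, forall i, `|ultra_eval (w i) gam' - gam k (v i k)| <= e.
  exact: filter_forall.
apply: filterS => k wk b; apply: aP; rewrite /good.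
apply: (@le_trans _ _ (D * `|\sum_(i < n) a k i *: v i k|)).
  by rewrite ler_peMl.
rewrite -(gamP k).2 (linear_map_comb (gamP k).1.1).
have := le_trans (ler_norm _) (ultra_eval_le (\sum_(i < n) a k i *: w i) gam').
rewrite (linear_map_comb (ultra_eval_linear gam')) => h.
rewrite -lerBlDl (le_trans (lerB (lexx _) h)) // -sumrB mulr_sumr.
apply: ler_sum => i _; rewrite -scalerBr; apply: le_trans (ler_norm _) _.
by rewrite normrM mulrC distrC ler_wpM2r.
Qed.

Hypothesis A_maximal : maximal A.

(* After a quotient map [ultra_map] is evaluated, up to [e], at finitely many
   samples [gam]; these are norm-one functionals on [G2 k], so that the resulting
   finite-rank approximation factors through [T k] for a single [k]. *)
Lemma ultra_map_ideal : ideal_ops A ultra_map.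
Proof.
have [AE _] := A_maximal ultra_space (bounded_banach (R := R) Gam2).
rewrite -[ideal_ops A _]/(op_component (ideal_class A) _) AE; split.
  split; first exact: ultra_map_linear.
  by exists 1 => w; rewrite mul1r ultra_map_le.
(* Maximality asks only for a finite bound: 2 comes from lifting [M] to [G1 k], [C] from [T k], and
   1 from the perturbation. *)
apply: (@le_lt_trans _ _ (2 * C + 1)%:E); last exact: ltry.
apply: ge_ereal_sup => _ [M [fM [L [fL ->]]]].
pose S (x : finite_dim_banach fM) : finite_dim_banach fL :=
  quot_map L (ultra_map (subspace_incl x)).
rewrite -[_ \o _]/S /=.
have lS : linear S.
  move=> a x y; rewrite /S -(@quot_map_linear _ _ L) -ultra_map_linear.
  by congr (quot_map L (ultra_map _)).
have [n [b [c [K K0 cs]]]] :=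
  @finite_dim_coordinates R (finite_dim_banach fM : normedModType R) fM.
have [cK cE cu] := cs.
pose e := (2 * n%:R * K + 1)^-1.
have nK : 0 <= n%:R * K by rewrite mulr_ge0 // ltW.
have nK1 : 0 < 2 * n%:R * K + 1 by lra.
have e0 : 0 < e by rewrite invr_gt0.
have eP : 2 * (e * (n%:R * K)) <= 1.
  by rewrite mulrCA mulrC ler_pdivrMr // mul1r -mulrA; lra.
pose w i : ultra_space := subspace_incl (b i).
have /choice[v vP] i : exists v : forall k, G1 k, forall gam : Gam1, \forall k \near U,
    `|ultra_eval (w i) gam - sval gam k (v k)| <= e.
  exact: ultra_eval_approx.
have S0 : exists gam : Gam2, True.
  have z k : functional 1 ((fun=> 0) : G2 k -> R).
    by split=> [u x y|x]; rewrite ?scaler0 ?addr0 // normr0 mul1r.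
  by exists (exist _ _ z).
have wle i (gam : Gam2) : `|bval (ultra_map (w i)) gam| <= \sum_j `|w j|.
  apply: le_trans (bval_le _ _) _; apply: le_trans (ultra_map_le _) _.
  by rewrite (bigD1 i) //= lerDl sumr_ge0.
have [J [code [sample smp]]] := finite_sampling S0 wle e0.
have near1 : \forall k \near U, forall j i,
    `|bval (ultra_map (w i)) (sample j) - sval (sample j) k (T (v i k))| <= e.
  apply: filter_forall => j; apply: filter_forall => i.
  exact: vP i (comp_T (sample j)).
have [k [k1 k2]] := filter_ex (filterI near1 (ultra_lift_le vP)).
pose Jk (x : finite_dim_banach fM) : G1 k := \sum_(i < n) c i x *: v i k.
have lJk : linear Jk.
  move=> a x y; rewrite /Jk scaler_sumr -big_split /=; apply: eq_bigr => i _.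
  by rewrite (cK i).1 scalerDl scalerA.
have Jkle x : `|Jk x| <= 2 * `|x|.
  apply: le_trans (k2 (fun i => c i x)) _.
  have -> : \sum_(i < n) c i x *: w i = subspace_incl x.
    by rewrite [in RHS](cE x) (linear_map_comb (@subspace_incl_linear _ _ M)).
  have : \sum_(i < n) `|c i x| <= n%:R * K * `|x|.
    rewrite -mulrA mulr_natl -[X in _ *+ X](card_ord n) -sumr_const.
    by apply: ler_sum => i _; exact: (cK i).2.
  move=> /(ler_wpM2l (ltW e0)); rewrite mulrA => h.
  have := ler_wpM2r (normr_ge0 x) eP; rewrite -[`|subspace_incl x|]/`|x|.
  by move: h (normr_ge0 x); lra.
have Rb (y : G2 k) : exists r : R, forall gam : Gam2, `|sval (sample (code gam)) k y| <= r.
  by exists `|y| => gam; have := (svalP (sample (code gam)) k).2 y; rewrite mul1r.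
(* Evaluation at [gam] is replaced by evaluation at its sample, which makes sense on the single
   space [G2 k]. *)
pose Rk (y : G2 k) : finite_dim_banach fL := quot_map L (mk_bval (Rb y)).
have lRk : linear Rk.
  move=> a x y; rewrite /Rk -(@quot_map_linear _ _ L); congr (quot_map L _).
  by apply: bval_ext => gam; rewrite bval_linear !bval_mk (svalP (sample (code gam)) k).1.
have Rkle y : `|Rk y| <= 1 * `|y|.
  rewrite mul1r; apply: le_trans (quot_map_le L _ : `|Rk y| <= _) _.
  apply: bval_norm_le => // gam.
  by rewrite bval_mk; have := (svalP (sample (code gam)) k).2 y; rewrite mul1r.
have [ATJ Tle] := ideal_comp_le lJk lRk (ler0n R 2) ler01 Jkle Rkle (AT k).1.
have [AS _] := ideal_finite_rank A (ltW K0) cs lS.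
rewrite asboolT // lee_fin.
have lTJ : linear (Rk \o @T k \o Jk) by have [] := ideal_bounded ATJ.
have SRe i : `|S (b i) - (Rk \o @T k \o Jk) (b i)| <= e + e.
  rewrite /= (_ : Jk (b i) = v i k); last first.
    rewrite /Jk (bigD1 i) //= (coordinate_dual _ _ cs) eqxx scale1r big1 ?addr0 // => j ji.
    by rewrite (coordinate_dual _ _ cs) eq_sym (negPf ji) scale0r.
  rewrite /S /Rk -(linear_mapB (@quot_map_linear _ _ L)).
  apply: le_trans (quot_map_le L _) _; apply: bval_norm_le => [|gam].
    by rewrite addr_ge0 // ltW.
  rewrite (linear_mapB (bval_linear gam)) bval_mk.
  rewrite -(subrKA (bval (ultra_map (w i)) (sample (code gam)))).
  by apply: le_trans (ler_normD _ _) _; rewrite lerD ?smp ?k1.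
apply: le_trans (ideal_perturb (ltW K0) cs lS lTJ ATJ SRe) _.
move: Tle (AT k).2 eP; lra.
Qed.

End UltraImage.

Lemma ultra_bounded_cvg (R : realType) (I : Type) (U : set_system I) (a : I -> R) (B : R) :
  UltraFilter U -> (forall k, `|a k| <= B) -> exists l : R, a @ U --> l.
Proof.
move=> UU aB.
have [|l [_ cl]] := @segment_compact R (- B) B (a @ U) _.
  by apply: nearW => k /=; rewrite in_itv /= -ler_norml.
exists l; apply/cvgrPdist_lt => e e0.
have [//|nU] := in_ultra_setVsetC [set k | `|l - a k| < e] UU.
have [||x [/= nx xe]] := cl (a @` ~` [set k | `|l - a k| < e]) (ball l e).
- by apply: (@filterS _ U _ _ _ _ nU) => k nk; exists k.
- exact: nbhsx_ballx.
- by case: nx xe => k nk <-; rewrite -ball_normE.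
Qed.

(** Lists are directed by inclusion, so that along [U] any finite set of points eventually belongs
    to [k]. *)
Lemma exists_ultra_finite (T : eqType) : exists2 U : set_system (seq T), UltraFilter U &
  forall s : seq T, \forall k \near U, {subset s <= k}.
Proof.
pose F := filter_from setT (fun s : seq T => [set k : seq T | {subset s <= k}]).
have FF : ProperFilter F.
  apply: filter_from_proper; last by move=> s _; exists s => x.
  apply: filter_from_filter; first by exists [::].
  move=> s t _ _; exists (s ++ t) => // k stk; split=> x xs; apply: stk;
    by rewrite mem_cat xs ?orbT.
have [U [UU FU]] := ultraFilterLemma FF; exists U => // s.
by apply: FU; exists s.
Qed.

(** * The limit of the finite factorizations and its derivative *)

Section UltraLipschitz.
Context {R : realType} {M : banach R} (U : set_system (seq M)) {UU : UltraFilter U}.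
Hypothesis U_finite : forall s : seq M, \forall k \near U, {subset s <= k}.
Context (A : banach_ideal R) (C D : R) (G1 G2 : seq M -> banach R).
Context (T : forall k, G1 k -> G2 k) (g : forall k, M -> G1 k).
Hypothesis (D1 : 1 <= D) (CD : C <= D).
Hypothesis AT : forall k, ideal_ops A (@T k) /\ ideal_norm A (@T k) <= C.
Hypothesis g_le : forall k x, `|g k x| <= `|x|.
Hypothesis g_lip : forall k x y, x \in k -> y \in k -> `|g k x - g k y| <= `|x - y|.

Let Gam1 := functional_family G1 D.
Let D0 : 0 <= D. Proof. exact: le_trans D1. Qed.

Let family_le (gam : Gam1) x k : `|sval gam k (g k x)| <= D * `|x|.
Proof.
apply: le_trans ((svalP gam k).2 _) _.
by rewrite ler_wpM2l ?g_le.
Qed.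

Let lim_ex (gam : Gam1) x : exists l : R, (fun k => sval gam k (g k x)) @ U --> l.
Proof. by apply: ultra_bounded_cvg => k; exact: family_le. Qed.

Let limg x gam := projT1 (cid (lim_ex gam x)).

Let limgP x gam : (fun k => sval gam k (g k x)) @ U --> limg x gam.
Proof. exact: projT2 (cid (lim_ex gam x)). Qed.

(** The maps [g k] are nonexpansive only on [k], but [x] and [y] eventually belong to [k]. *)
Let limg_lip x y gam : `|limg x gam - limg y gam| <= D * `|x - y|.
Proof.
have h : (fun k => sval gam k (g k x) - sval gam k (g k y)) @ U --> limg x gam - limg y gam.
  by apply: cvgB; exact: limgP.
apply: (@closed_cvg _ _ U _ (fun k => sval gam k (g k x) - sval gam k (g k y))
  [set z : R | `|z| <= D * `|x - y|]) h.
- rewrite (_ : [set z | _] = closed_ball_ Num.Def.normr (0 : R) (D * `|x - y|)).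
    exact: closed_closed_ball_.
  by apply/seteqP; split => z; rewrite /closed_ball_ /= sub0r normrN.
- have := U_finite [:: x; y]; apply: filterS => k kxy /=.
  rewrite -(linear_mapB (svalP gam k).1); apply: le_trans ((svalP gam k).2 _) _.
  by rewrite ler_wpM2l // g_lip // kxy // !inE eqxx ?orbT.
Qed.

Let limg0 gam : limg 0 gam = 0.
Proof.
apply: (@cvg_unique R _ ((fun k => sval gam k (g k 0)) @ U));
  [exact: norm_hausdorff|exact: limgP|].
apply: cvg_near_cst; apply: nearW => k.
have := g_le k 0; rewrite normr0 normr_le0 => /eqP ->.
by rewrite (linear_map0 (svalP gam k).1).
Qed.

Let limg_bounded x : exists c : R, forall gam, `|limg x gam| <= c.
Proof.
by exists (D * `|x|) => gam; have := limg_lip x 0 gam; rewrite limg0 !subr0.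
Qed.

Let limg_ultra x : subspace_set (@ultra_subspace R _ U _ G1 D) (mk_bval (@limg_bounded x)).
Proof.
move=> e e0; exists (fun k => g k x); split; first by exists `|x| => k.
move=> gam; rewrite bval_mk; by move/cvgrPdist_le: (@limgP x gam) => /(_ _ e0).
Qed.

Definition ultra_lift (x : M) : @ultra_space R _ U _ G1 D :=
  mk_closed (L := ClosedSubspace (@ultra_closed R _ U _ G1 D)) (limg_ultra x).

Lemma ultra_lift_eval x gam :
  (fun k => sval gam k (g k x)) @ U --> ultra_eval (ultra_lift x) gam.
Proof. exact: limgP. Qed.

Lemma ultra_lift0 : ultra_lift 0 = 0.
Proof.
apply: closed_incl_inj; rewrite (linear_map0 (@closed_incl_linear _ _ _)).
by apply: bval_ext => gam; rewrite (linear_map0 (bval_linear gam)) bval_mk limg0.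
Qed.

Lemma ultra_lift_lip x y : `|ultra_lift x - ultra_lift y| <= D * `|x - y|.
Proof.
rewrite -closed_incl_norm (linear_mapB (@closed_incl_linear _ _ _)).
apply: bval_norm_le => [|gam]; first by rewrite mulr_ge0.
by rewrite (linear_mapB (bval_linear gam)) !bval_mk.
Qed.

Hypothesis A_maximal : maximal A.
Hypothesis gateaux : forall (F : banach R) (f : M -> F),
  @ideal_Lip R A (norm_pm M) F f -> exists x0 : M, gateaux_differentiable f x0.

Let f x := ultra_map CD AT (ultra_lift x).

Let f_ideal_Lip : @ideal_Lip R A (norm_pm M) _ f.
Proof.
exists (@ultra_space R _ U _ G1 D), ultra_lift, (ultra_map CD AT); split => //.
- split; first exact: ultra_lift0.
  by exists D; split => // x y; exact: ultra_lift_lip.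
- exact: ultra_map_ideal.
Qed.

(** Difference quotients of [f] at [x0] approach a linear map, hence are almost additive at a
    suitable [t], and so are those of [T \o g k] for a suitable [k]. This [k] is also made to
    contain the points where its factorization is going to be used. *)
Lemma finite_stage n (b : 'I_n -> M) (Q : nat) (eta : R) : 0 < eta ->
  exists (x0 : M) (t : R) (k : seq M), let blow u :=
      t^-1 *: (T (g k (x0 + t *: u)) - T (g k x0)) in
    [/\ t != 0, x0 \in k,
      forall s : seq 'I_n, (size s <= Q)%N -> x0 + t *: \sum_(i <- s) b i \in k &
      forall s : seq 'I_n, (size s <= Q)%N ->
        `|blow (\sum_(i <- s) b i) - \sum_(i <- s) blow (b i)| <= eta].
Proof.
move=> eta0; have [x0 [Df [lD _] diff]] := gateaux f_ideal_Lip.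
pose e := eta / (2 * (Q%:R + 1)).
have Q1 : (0 : R) < Q%:R + 1 by rewrite ltr_wpDl.
have e0 : 0 < e by rewrite divr_gt0 // mulr_gt0.
(* Lists of length at most [Q] form a finite type, so one [t] and then one [k] serve them all. *)
pose P (s : Q.-bseq 'I_n) : M := \sum_(i <- s) b i.
pose dq t u := t^-1 *: (f (x0 + t *: u) - f x0).
have near_dq u : \forall t \near (0 : R)^', `|Df u - dq t u| <= e.
  by move/cvgrPdist_le : (diff u) => /(_ _ e0).
have [t [t0 [tP tb]]] : exists t : R, t != 0 /\ (forall s, `|Df (P s) - dq t (P s)| <= e) /\
    forall i, `|Df (b i) - dq t (b i)| <= e.
  have h1 : \forall t \near (0 : R)^', forall s, `|Df (P s) - dq t (P s)| <= e.
    by apply: filter_forall => s; exact: near_dq.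
  have h2 : \forall t \near (0 : R)^', forall i, `|Df (b i) - dq t (b i)| <= e.
    by apply: filter_forall => i; exact: near_dq.
  have h3 : \forall t \near (0 : R)^', t != 0 by exact: nbhs_dnbhs_neq.
  by have [t [[H1 H2] H3]] := filter_ex (filterI (filterI h1 h2) h3); exists t.
have dqP s : `|dq t (P s) - \sum_(i <- s) dq t (b i)| <= eta / 2.
  have -> : dq t (P s) - \sum_(i <- s) dq t (b i) =
      \sum_(i <- s) (Df (b i) - dq t (b i)) - (Df (P s) - dq t (P s)).
    rewrite sumrB [X in Df X]/P (linear_map_sum lD) opprB [RHS]addrC.
    by rewrite subrKA.
  apply: le_trans (ler_normB _ _) _.
  have : `|\sum_(i <- s) (Df (b i) - dq t (b i))| <= Q%:R * e.
    apply: le_trans (ler_norm_sum _ _ _) _.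
    apply: (@le_trans _ _ (\sum_(i <- s) e)); first by apply: ler_sum => i _.
    rewrite big_const_seq count_predT iter_addr_0 -(mulr_natl e) ler_wpM2r ?(ltW e0) //.
    by rewrite ler_nat; case: s.
  have -> : eta / 2 = Q%:R * e + e.
    by rewrite /e; field; rewrite gt_eqF.
  by move=> h1; apply: lerD h1 (tP s).
pose blow k u := t^-1 *: (T (g k (x0 + t *: u)) - T (g k x0)).
pose W (s : Q.-bseq 'I_n) k := blow k (P s) - \sum_(i <- s) blow k (b i).
have near_W s : \forall k \near U, `|W s k| <= eta.
  (* One norming functional for each [k] makes up a single index [gam']. The limit at this one index
     bounds the norm of [W s k] for all [k] near [U]. *)
  pose gamE k := cid (norming_functional (W s k) ler01).
  pose gam k := projT1 (gamE k).
  have gamP k : functional 1 (gam k) /\ gam k (W s k) = 1 * `|W s k|.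
    exact: projT2 (gamE k).
  pose gam' : functional_family G2 1 := exist _ gam (fun k => (gamP k).1).
  have fE x : (fun k => gam k (T (g k x))) @ U --> bval (f x) gam'.
    by rewrite /f /ultra_map bval_mk; exact: ultra_lift_eval.
  have blE u : (fun k => gam k (blow k u)) @ U --> bval (dq t u) gam'.
    rewrite (_ : (fun k => _) =
      (fun k => t^-1 * (gam k (T (g k (x0 + t *: u))) - gam k (T (g k x0))))).
      rewrite (linear_mapZ (bval_linear gam')) (linear_mapB (bval_linear gam')).
      by apply: cvgMr; apply: cvgB; exact: fE.
    by apply/funext => k; rewrite (linear_mapZ (gamP k).1.1) (linear_mapB (gamP k).1.1).
  have sE (r : seq 'I_n) : (fun k => gam k (\sum_(i <- r) blow k (b i))) @ U -->
      bval (\sum_(i <- r) dq t (b i)) gam'.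
    elim: r => [|i r IHr].
      rewrite big_nil (linear_map0 (bval_linear gam')); apply: cvg_near_cst.
      by apply: nearW => k; rewrite big_nil (linear_map0 (gamP k).1.1).
    rewrite big_cons (linear_mapD (bval_linear gam')).
    rewrite (_ : (fun k => _) =
      (fun k => gam k (blow k (b i)) + gam k (\sum_(i <- r) blow k (b i)))).
      exact: cvgD.
    by apply/funext => k; rewrite big_cons (linear_mapD (gamP k).1.1).
  have WE : (fun k => gam k (W s k)) @ U --> bval (dq t (P s) - \sum_(i <- s) dq t (b i)) gam'.
    rewrite (linear_mapB (bval_linear gam')).
    rewrite (_ : (fun k => _) =
      (fun k => gam k (blow k (P s)) - gam k (\sum_(i <- s) blow k (b i)))).
      exact: cvgB.
    by apply/funext => k; rewrite (linear_mapB (gamP k).1.1).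
  have eta20 : 0 < eta / 2 by rewrite divr_gt0.
  move/cvgrPdist_le : WE => /(_ _ eta20); apply: filterS => k.
  rewrite (gamP k).2 mul1r ler_norml => /andP[+ _].
  have := le_trans (ler_norm _) (bval_le (dq t (P s) - \sum_(i <- s) dq t (b i)) gam').
  by move: (dqP s); lra.
have near_W' : \forall k \near U, forall s, `|W s k| <= eta by exact: filter_forall.
have near_pts := U_finite (x0 :: [seq x0 + t *: P s | s <- enum {: Q.-bseq 'I_n}]).
have [k [kW kP]] := filter_ex (filterI near_W' near_pts).
exists x0, t, k; split => //.
- by apply: kP; rewrite inE eqxx.
- move=> s sQ; apply: kP; rewrite inE; apply/orP; right; apply/mapP.
  by exists (Bseq sQ); rewrite ?mem_enum.
- by move=> s sQ; exact: kW (Bseq sQ).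
Qed.

End UltraLipschitz.

(** * The estimate on finite-dimensional spaces *)

(** The Lipschitz constants are absorbed into [fact_T]. Outside [k] only [fact_g_le] is known; it
    makes the limits along an ultrafilter exist at every point. *)
Record factorization (R : realType) (A : banach_ideal R) (M N : banach R)
    (S : M -> N) (C : R) (k : seq M) := Factorization {
  fact_G1 : banach R;
  fact_G2 : banach R;
  fact_g : M -> fact_G1;
  fact_T : fact_G1 -> fact_G2;
  fact_h : fact_G2 -> N;
  fact_ideal : ideal_ops A fact_T /\ ideal_norm A fact_T <= C;
  fact_g_le : forall x, `|fact_g x| <= `|x|;
  fact_g_lip : forall x y, x \in k -> y \in k ->
    `|fact_g x - fact_g y| <= `|x - y|;
  fact_h_lip : forall x y, `|fact_h x - fact_h y| <= `|x - y|;
  factE : forall x, x \in k -> S x = fact_h (fact_T (fact_g x))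
}.

Arguments fact_g {R A M N S C k} f _.
Arguments fact_T {R A M N S C k} f _.
Arguments fact_h {R A M N S C k} f _.
Arguments fact_g_le {R A M N S C k} f _.
Arguments fact_g_lip {R A M N S C k} f _ _ _ _.
Arguments fact_h_lip {R A M N S C k} f _ _.
Arguments factE {R A M N S C k} f _ _.

Section LocalEstimate.
Context {R : realType} (A : banach_ideal R) {M N : banach R} (S : M -> N) (C : R).
Hypothesis (A_maximal : maximal A) (fM : finite_dim M) (fN : finite_dim N).
Hypothesis gateaux : forall (F : banach R) (f : M -> F),
  @ideal_Lip R A (norm_pm M) F f -> exists x0 : M, gateaux_differentiable f x0.
Hypothesis (lS : linear S) (C0 : 0 <= C).
Hypothesis fact_ex : forall k : seq M, exists _ : factorization A S C k, True.

(** The factors [1 + tau] bound the operators [Bk] and [Lx]; the last [tau] pays for replacing [S]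
    by [Bk \o T \o Lx]. *)
Let local_estimate_eps (n : nat) (b : 'I_n -> M) (c : 'I_n -> M -> R) (K tau : R) :
  0 < K -> coordinate_system K b c -> 0 < tau -> tau <= 1 ->
  ideal_norm A S <= (1 + tau) * C * (1 + tau) + tau.
Proof.
move=> K0 cs tau0 tau1; have [cK cE cu] := cs.
have [d [nu [cN [KN KN0 csN]]]] := finite_dim_coordinates fN.
have nK : 0 <= n%:R * K by rewrite mulr_ge0 // ltW.
have nK1 : 0 < n%:R * K + 1 by lra.
pose B := \sum_i `|b i|.
have B0 : 0 <= B by apply: sumr_ge0.
have bB i : `|b i| <= B by rewrite /B (bigD1 i) //= lerDl sumr_ge0.
pose eN := tau / (2 * (n%:R * K + 1)).
have eN0 : 0 < eN by rewrite divr_gt0 // mulr_gt0.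
(* [Q2] and [eta2] depend neither on the space [G2] nor on the map to be linearized, so they can be
   fixed before [k]. *)
have [Q2 [eta2 eta20 lift]] := local_lift KN0 csN (S \o b) tau0 eN0 (mulr_ge0 C0 B0).
have [m0 [N0 [m00 incr]]] := box_increment_real n B0 (ltW K0) tau0.
(* The successor leaves room for one more step [b i] from a point of the averaging box, as in
   [TL]. *)
pose Q := maxn Q2 (\sum_(i <- index_enum 'I_n) m0 + N0).+1.
pose eta1 := Num.min eta2 (tau / (8 * (n%:R * K + 1))).
have eta10 : 0 < eta1 by rewrite lt_min eta20 divr_gt0 // mulr_gt0.
have eta12 : eta1 <= eta2 by rewrite ge_min lexx.
have eta1P : eta1 * (8 * (n%:R * K + 1)) <= tau.
  by rewrite -ler_pdivlMr ?mulr_gt0 // ge_min lexx orbT.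
have [U UU Ufin] := exists_ultra_finite M.
pose fac k := projT1 (cid (fact_ex k)).
have D1 : 1 <= Num.max 1 C by rewrite le_max lexx.
have CD : C <= Num.max 1 C by rewrite le_max lexx orbT.
have [x0 [t [k [t0 kx0 kpt blow_add]]]] :=
  @finite_stage R M U UU Ufin A C (Num.max 1 C) (fun k => fact_G1 (fac k))
   (fun k => fact_G2 (fac k)) (fun k => fact_T (fac k)) (fun k => fact_g (fac k))
   D1 CD (fun k => fact_ideal (fac k)) (fun k => fact_g_le (fac k))
   (fun k => fact_g_lip (fac k)) A_maximal gateaux n b Q eta1 eta10.
move: (fac k) kx0 kpt blow_add => [G1 G2 g T h [AT TC] /= _ glip hlip SE] kx0 kpt.
have tn : 0 < `|t| by rewrite normr_gt0.
have [lT _] := ideal_bounded AT.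
pose gb u := t^-1 *: (g (x0 + t *: u) - g x0).
pose fb u := t^-1 *: (T (g (x0 + t *: u)) - T (g x0)); rewrite -/fb => blow_add.
have fbE u : fb u = T (gb u) by rewrite /fb /gb (linear_mapZ lT) (linear_mapB lT).
have gblip (s s' : seq 'I_n) : (size s <= Q)%N -> (size s' <= Q)%N ->
    `|gb (\sum_(i <- s) b i) - gb (\sum_(i <- s') b i)| <=
    `|\sum_(i <- s) b i - \sum_(i <- s') b i|.
  move=> sQ sQ'; rewrite /gb -scalerBr normrZ normfV ler_pdivrMl //.
  rewrite opprB subrKA (le_trans (glip _ _ (kpt _ sQ) (kpt _ sQ'))) //.
  by rewrite opprD addrACA subrr add0r -scalerBr normrZ.
have Tle x : `|T x| <= C * `|x|.
  by apply: le_trans (op_le_ideal_norm _ AT) _; rewrite ler_wpM2r.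
have gb0 : gb 0 = 0 by rewrite /gb scaler0 addr0 subrr scaler0.
have Q1 : (1 <= Q)%N by rewrite /Q leq_max orbT.
have gbi i : `|gb (b i)| <= `|b i|.
  have := gblip [:: i] [::] Q1 (leq0n _).
  by rewrite big_seq1 big_nil gb0 !subr0.
have fbB i : `|fb (b i)| <= C * B.
  rewrite fbE; apply: le_trans (Tle _) _; rewrite ler_wpM2l //.
  exact: le_trans (gbi i) (bB i).
(* [gb], [fb] and [hb] are blow-ups with scale [t]. As [S] is linear, [hb] sends the values of [fb]
   on the grid exactly to those of [S]; as [fb] is almost additive, [lift] applies. *)
pose hb y := t^-1 *: (h (T (g x0) + t *: y) - h (T (g x0))).
have hblip u v : `|hb u - hb v| <= `|u - v|.
  rewrite /hb -scalerBr normrZ normfV ler_pdivrMl //.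
  rewrite opprB subrKA (le_trans (hlip _ _)) //.
  by rewrite opprD addrACA subrr add0r -scalerBr normrZ.
have hbf (s : seq 'I_n) : (size s <= Q)%N ->
    hb (fb (\sum_(i <- s) b i)) = \sum_(i <- s) S (b i).
  move=> sQ; rewrite /hb /fb scalerA divff // scale1r addrCA subrr addr0.
  rewrite -!SE ?kpt // (linear_mapD lS) addrAC subrr add0r (linear_mapZ lS) scalerA.
  by rewrite mulVf // scale1r (linear_map_sum lS).
have [|Bk [lB Ble Bs]] := lift G2 (fun i => fb (b i)) hb hblip fbB.
  move=> s sQ2; have sQ : (size s <= Q)%N by rewrite /Q leq_max sQ2.
  rewrite -(hbf _ sQ); apply: le_trans (hblip _ _) _; rewrite distrC.
  exact: le_trans (blow_add _ sQ) eta12.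
pose L i := box_increment b (fun=> m0) (index_enum 'I_n) gb i.
pose Lx (x : M) : G1 := \sum_(i < n) c i x *: L i.
have lLx : linear Lx.
  move=> a x y; rewrite /Lx scaler_sumr -big_split /=; apply: eq_bigr => i _.
  by rewrite (cK i).1 scalerDl scalerA.
have gridQ x : grid b (\sum_(i <- index_enum 'I_n) m0 + N0) x ->
    exists2 s : seq 'I_n, (size s <= Q)%N & x = \sum_(i <- s) b i.
  move=> [s sN ->]; exists s => //; rewrite /Q leq_max; apply/orP; right.
  exact: leq_trans sN (leqnSn _).
have Lxle x : `|Lx x| <= (1 + tau) * `|x|.
  have [->|xn0] := eqVneq x 0.
    by rewrite (linear_map0 lLx) !normr0 mulr0.
  have nx : 0 < `|x| by rewrite normr_gt0.
  (* Normalizing bounds the coordinates by [K] and turns the additive error of [incr] into the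
     factor [1 + tau]. *)
  pose y := `|x|^-1 *: x.
  have y1 : `|y| = 1 by rewrite normrZ normfV normr_id mulVf // gt_eqF.
  have := incr _ _ _ b (fun=> m0) (index_enum 'I_n) gb (card_ord n) _ _ bB _ (c^~ y).
  rewrite -(cE y) y1 -/(Lx y) => Lxy.
  have : `|Lx y| <= 1 + tau.
    apply: Lxy => //.
    - by move=> u v /gridQ[s sQ ->] /gridQ[s' sQ' ->]; exact: gblip.
    - by move=> i; have := (cK i).2 y; rewrite y1 mulr1.
  by rewrite (linear_mapZ lLx) normrZ normfV normr_id ler_pdivrMl // mulrC.
(* [T] commutes with averages, and by almost additivity every increment of [fb] along [b i] over the
   box is close to [fb (b i)]. *)
have TL i : `|T (L i) - fb (b i)| <= eta1 + eta1.
  rewrite /L /box_increment (box_avg_linear _ _ _ lT).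
  have pl : pos_box (grid_box b (fun=> m0) (index_enum 'I_n)).
    by rewrite /pos_box all_map; apply/allP => j _.
  rewrite -(box_avg_cst (fb (b i)) 0 pl) -box_avgB; apply: box_avg_bound => //.
  apply: in_boxW (in_grid_box _ _ (grid0 b 0)) => _ [s sN ->] /=; rewrite add0n in sN.
  have sQ : (size (i :: s) <= Q)%N.
    rewrite /Q leq_max; apply/orP; right; rewrite ltnS.
    exact: leq_trans sN (leq_addr _ _).
  rewrite (linear_mapB lT) -!fbE.
  have := blow_add _ sQ; have := blow_add _ (ltnW sQ : (size s <= Q)%N).
  rewrite !big_cons [b i + _]addrC => h1 h2.
  rewrite [X in `|X|](_ : _ = (fb (\sum_(j <- s) b j + b i) -
       (fb (b i) + \sum_(j <- s) fb (b j)))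
     - (fb (\sum_(j <- s) b j) - \sum_(j <- s) fb (b j))).
    by apply: le_trans (ler_normB _ _) _; rewrite lerD.
  by rewrite opprB opprD !addrA subrK addrAC.
have tau1' : 0 <= 1 + tau by rewrite addr_ge0 // ltW.
have [ABL BLle] := ideal_comp_le lLx lB tau1' tau1' Lxle Ble AT.
have lBL : linear (Bk \o T \o Lx) by have [] := ideal_bounded ABL.
have SBL i : `|S (b i) - (Bk \o T \o Lx) (b i)| <= eN + 2 * (eta1 + eta1).
  rewrite /= (_ : Lx (b i) = L i); last first.
    rewrite /Lx (bigD1 i) //= (coordinate_dual _ _ cs) eqxx scale1r big1 ?addr0 // => j ji.
    by rewrite (coordinate_dual _ _ cs) eq_sym (negPf ji) scale0r.
  rewrite -(subrKA (Bk (fb (b i)))); apply: le_trans (ler_normD _ _) _.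
  rewrite lerD //; first by rewrite distrC; exact: Bs.
  rewrite distrC -(linear_mapB lB); apply: le_trans (Ble _) _.
  by rewrite ler_pM // ?TL //; move: tau1; lra.
have AS := (ideal_finite_rank A (ltW K0) cs lS).1.
apply: le_trans (ideal_perturb (ltW K0) cs lS lBL ABL SBL) _.
have Cle : (1 + tau) * ideal_norm A T * (1 + tau) <= (1 + tau) * C * (1 + tau).
  by rewrite ler_wpM2r // ler_wpM2l.
have eNP : n%:R * K * eN <= tau / 2.
  rewrite /eN mulrA ler_pdivrMr ?mulr_gt0 //.
  by have := mulr_ge0 nK (ltW tau0); move: tau0; lra.
apply: lerD; first exact: le_trans BLle Cle.
have := eta1P; have := ltW eta10; rewrite mulrA !mulrDr; move: eNP; nra.
Qed.

Lemma local_estimate : ideal_ops A S /\ ideal_norm A S <= C.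
Proof.
have [n [b [c [K K0 cs]]]] := finite_dim_coordinates fM.
split; first exact: (ideal_finite_rank A (ltW K0) cs lS).1.
apply/ler_addgt0Pr => e e0.
have C1 : 0 < 3 * C + 1 by move: C0; lra.
(* For [tau <= 1] the bound [(1 + tau) * C * (1 + tau) + tau] is at most [C + tau * (3 * C + 1)]. *)
pose tau := Num.min 1 (e / (3 * C + 1)).
have tau0 : 0 < tau by rewrite lt_min ltr01 divr_gt0.
have tau1 : tau <= 1 by rewrite ge_min lexx.
have tauP : tau * (3 * C + 1) <= e by rewrite -ler_pdivlMr // ge_min lexx orbT.
apply: le_trans (local_estimate_eps K0 cs tau0 tau1) _.
have : tau * tau <= tau by rewrite ler_piMr // ltW.
by move/(ler_wpM2r C0); lra.
Qed.

End LocalEstimate.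

(** * The maximal hull of Lipschitz-factorable maps *)

Section LipschitzConstant.
Context {R : realType} {X Y : metricType R}.
Implicit Types f : X -> Y.

Lemma Lip_ge0 f : lip_bounds f !=set0 -> 0 <= Lip f.
Proof. by move=> f0; apply: lb_le_inf => // k []. Qed.

Lemma Lip_le f x y : lip_bounds f !=set0 -> mdist (f x) (f y) <= Lip f * mdist x y.
Proof.
move=> f0; have [->|xy] := eqVneq x y; first by rewrite !mdistxx mulr0.
rewrite -ler_pdivrMr ?mdist_gt0 //; apply: lb_le_inf => // k [_ kf].
by rewrite ler_pdivrMr ?mdist_gt0.
Qed.

Lemma Lip_le_bound f k : 0 <= k -> (forall x y, mdist (f x) (f y) <= k * mdist x y) ->
  Lip f <= k.
Proof. by move=> k0 kf; apply: ge_inf; [exists 0 => ? []|]. Qed.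

End LipschitzConstant.

Section Factorizations.
Context {R : realType} (A : banach_ideal R).

Lemma Lip_ideal_Lip_norm_ge0 (X : pointed_metric R) (E : banach R) (f : X -> E) :
  (0 <= lip_class_norm (Lip_ideal_Lip A) f)%E.
Proof.
apply: le_ereal_inf_tmp => _ [G1 [G2 [g1 [T [g2 [[[_ h1] AT [_ h2] _] ->]]]]]].
by rewrite lee_fin !mulr_ge0 ?Lip_ge0 // ideal_norm_ge0.
Qed.

Lemma ideal_sub_Lip_ideal_Lip (E F : banach R) (T : E -> F) : ideal_ops A T ->
  lip_component (Lip_ideal_Lip A) (T : norm_pm E -> F) /\
  (lip_class_norm (Lip_ideal_Lip A) (T : norm_pm E -> F) <= (ideal_norm A T)%:E)%E.
Proof.
move=> AT.
have id_lip (V : banach R) : forall x y : norm_metric V, mdist x y <= 1 * mdist x y.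
  by move=> x y; rewrite mul1r.
have fac : @Lip_ideal_Lip_factor R A (norm_pm E) F E F (fun x : E => x) T (fun y : F => y) T.
  by split => //; split => //; exists 1; split => //; exact: id_lip.
split; first by exists E, F, (fun x : E => x), T, (fun y : F => y).
apply: ge_ereal_inf; eexists.
  by exists E, F, (fun x : E => x), T, (fun y : F => y); split.
rewrite lee_fin -[leRHS]mulr1 -[X in _ <= X * 1]mul1r.
have Lid (V : banach R) : 0 <= @Lip R (norm_metric V) (norm_metric V) (fun y => y) <= 1.
  rewrite Lip_ge0 ?Lip_le_bound //; first exact: id_lip.
  by exists 1; split => //; exact: id_lip.
have /andP[E0 E1] := Lid E; have /andP[F0 F1] := Lid F.
have N0 := ideal_norm_ge0 AT.
by rewrite ler_pM ?mulr_ge0 // ler_wpM2r.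
Qed.

Lemma Lip_ideal_Lip_sub_max (X : pointed_metric R) (E : banach R) (f : X -> E) :
  (lip_max_norm (Lip_ideal_Lip A) f <= lip_class_norm (Lip_ideal_Lip A) f)%E.
Proof.
apply: ge_ereal_sup => _ [X0 [X00 [L [fL [_ ->]]]]].
apply: le_ereal_inf_tmp => _ [G1 [G2 [g1 [T [g2 [[h1 AT h2 fE] ->]]]]]].
have [h10 [k1 [k10 k1P]]] := h1; have [h20 [k2 [k20 k2P]]] := h2.
pose g1' (x : sub_pm X00) : G1 := g1 (set_val x).
pose g2' (y : G2) : finite_dim_banach fL := quot_map L (g2 y).
have q_lip (u v : E) : `|quot_map L u - quot_map L v| <= `|u - v|.
  by rewrite -(linear_mapB (@quot_map_linear _ _ L)) quot_map_le.
have b1 k : 0 <= k ->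
    (forall x y, @mdist R _ (g1 x : norm_metric G1) (g1 y) <= k * mdist x y) ->
    forall x y, @mdist R _ (g1' x : norm_metric G1) (g1' y) <= k * mdist x y.
  by move=> _ kP x y; exact: kP.
have b2 k :
    (forall x y, @mdist R _ (g2 x : norm_metric E) (g2 y) <=
      k * @mdist R (norm_metric G2) x y) ->
    forall x y, @mdist R _ (g2' x : norm_metric (finite_dim_banach fL)) (g2' y) <=
      k * @mdist R (norm_metric G2) x y.
  by move=> kP x y; apply: le_trans (q_lip _ _) _; exact: kP.
apply: ge_ereal_inf; eexists.
  exists G1, G2, g1', T, g2'; split; last by [].
  split => //.
  - by split=> //; exists k1; split => //; exact: b1.
  - split; last by exists k2; split => //; exact: b2.
    by rewrite /g2' h20 (linear_map0 (@quot_map_linear _ _ L)).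
  - by rewrite fE.
have N0 := ideal_norm_ge0 AT.
rewrite lee_fin !ler_pM ?mulr_ge0 ?Lip_ge0 //.
- by exists k1; split => //; exact: b1.
- by exists k2; split => //; exact: b2.
- by exists k1; split => //; exact: b1.
- apply: Lip_le_bound; first by rewrite Lip_ge0 //; exists k1.
  by apply: b1 => [|x y]; [rewrite Lip_ge0 //; exists k1|rewrite Lip_le //; exists k1].
- apply: Lip_le_bound; first by rewrite Lip_ge0 //; exists k2.
  by apply: b2 => x y; rewrite Lip_le //; exists k2.
Qed.

(** The Lipschitz constants of a factorization may vanish; enlarging them by [d] makes it possible
    to divide by them, and the strict inequality leaves room for this. *)
Lemma normalized_constants (a N b c : R) : 0 <= a -> 0 <= N -> 0 <= b -> a * N * b < c ->
  exists2 d, 0 < d & (a + d) * (b + d) * N <= c.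
Proof.
move=> a0 N0 b0 abc.
have s0 : 0 < N * (a + b + 1) + 1 by rewrite ltr_wpDl // mulr_ge0 // !addr_ge0.
pose d := Num.min 1 ((c - a * N * b) / (N * (a + b + 1) + 1)).
have d0 : 0 < d by rewrite lt_min ltr01 divr_gt0 // subr_gt0.
have d1 : d <= 1 by rewrite ge_min lexx.
have dP : d * (N * (a + b + 1) + 1) <= c - a * N * b.
  by rewrite -ler_pdivlMr // ge_min lexx orbT.
exists d => //.
have : d * d * N <= d * N by rewrite ler_wpM2r // ler_piMr // ltW.
by move: (ltW d0); lra.
Qed.

(** Strictness turns the infimum into an actual factorization on a finite set. Both Lipschitz
    factors are then made nonexpansive, and their constants go into the operator. *)
Lemma factorization_of_lip_max (E F : banach R) (T : E -> F) (C : R)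
    (M : subspace E) (fM : finite_dim (subspace_type M))
    (L : closed_subspace F) (fL : finite_dim (quot_type L)) (k : seq (finite_dim_banach fM)) :
  (lip_max_norm (Lip_ideal_Lip A) (T : norm_pm E -> F) < C%:E)%E ->
  exists _ : @factorization R A (finite_dim_banach fM) (finite_dim_banach fL)
    (quot_map L \o T \o @subspace_incl R E M) C k, True.
Proof.
move=> TC.
(* The set must contain the base point 0; comparison with it yields [g_le] on [X0]. *)
pose X0 : set (norm_pm E) := [set x | x = 0 :> E \/ exists2 y, y \in k & subspace_incl y = x].
have X00 : X0 (pm_point (norm_pm E)) by left.
have X0fin : finite_set X0.
  rewrite (_ : X0 = [set` (0 : E) :: [seq subspace_incl y | y <- k]]); first exact: finite_seq.
  apply/seteqP; split => x /=; rewrite inE.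
    by case=> [->|[y yk <-]]; rewrite ?eqxx // map_f ?orbT.
  by move=> /orP[/eqP|/mapP[y yk ->]]; [left|right; exists y].
have X0k (x : finite_dim_banach fM) : x \in k -> X0 (subspace_incl x).
  by move=> xk; right; exists x.
have : (lip_class_norm (Lip_ideal_Lip A) (X := sub_pm X00) (E := finite_dim_banach fL)
    (quot_map L \o T \o set_val) < C%:E)%E.
  apply: le_lt_trans TC; apply: le_ereal_sup_tmp; eexists; last exact: lexx.
  by exists X0, X00, L, fL.
move=> /ereal_inf_lt[_ [G1 [G2 [g1 [T2 [g2 [[[g10 h1] AT [g20 h2] gE] ->]]]]]]].
rewrite lte_fin.
set a := (X in X * _ * _); set b := (X in _ * X) => ltC.
have l10 : 0 <= a by exact: Lip_ge0.
have l20 : 0 <= b by exact: Lip_ge0.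
have N0 := ideal_norm_ge0 AT.
have [d d0 dP] := normalized_constants l10 N0 l20 ltC.
have a0 : 0 < a + d by rewrite ltr_wpDl.
have b0 : 0 < b + d by rewrite ltr_wpDl.
have g1le (x y : set_type X0) : `|g1 x - g1 y| <= (a + d) * `|(set_val x : E) - set_val y|.
  apply: le_trans (Lip_le (Y := norm_metric G1) x y h1) _.
  by apply: ler_wpM2r; [exact: mdist_ge0|rewrite lerDl ltW].
have g2le (x y : G2) : `|g2 x - g2 y| <= (b + d) * `|x - y|.
  apply: le_trans
    (@Lip_le R (norm_metric G2) (norm_metric (finite_dim_banach fL)) g2 x y h2) _.
  by apply: ler_wpM2r; [exact: mdist_ge0|rewrite lerDl ltW].
(* The value 0 off the finite set preserves [g_le], though not the Lipschitz bound. *)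
pose g (x : finite_dim_banach fM) : G1 := match pselect (X0 (subspace_incl x)) with
  | left Xx => (a + d)^-1 *: g1 (SigSub (mem_set Xx)) | right _ => 0 end.
have lT2 := (ideal_bounded AT).1.
have sclin : linear (fun y : G2 => ((a + d) * (b + d)) *: y).
  by move=> r x y; rewrite scalerDr !scalerA mulrC.
have idlin : linear (fun x : G1 => x) by [].
have ab0 : 0 <= (a + d) * (b + d) by rewrite mulr_ge0 // ltW.
have scle (y : G2) : `|((a + d) * (b + d)) *: y| <= (a + d) * (b + d) * `|y|.
  by rewrite normrZ ger0_norm.
have idle (x : G1) : `|x| <= 1 * `|x| by rewrite mul1r.
have [AT' T'le] := ideal_comp_le idlin sclin ler01 ab0 idle scle AT.
have gE' (x : finite_dim_banach fM) (Xx : X0 (subspace_incl x)) :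
    g x = (a + d)^-1 *: g1 (SigSub (mem_set Xx)).
  rewrite /g; case: pselect => // Xx'.
  by congr (_ *: g1 _); apply: val_inj.
have aV (z : G1) (r : R) : `|z| <= (a + d) * r -> `|(a + d)^-1 *: z| <= r.
  by move=> zr; rewrite normrZ ger0_norm ?invr_ge0 ?(ltW a0) // ler_pdivrMl.
have g_le x : `|g x| <= `|x|.
  rewrite /g; case: pselect => [Xx|_]; last by rewrite normr0.
  apply: aV; have := g1le (SigSub (mem_set Xx)) (pm_point (sub_pm X00)).
  by rewrite g10 !subr0.
have g_lip x y : x \in k -> y \in k -> `|g x - g y| <= `|x - y|.
  move=> /X0k Xx /X0k Xy; rewrite !gE' -scalerBr; apply: aV.
  exact: g1le (SigSub (mem_set Xx)) (SigSub (mem_set Xy)).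
have h_lip (x y : G2) :
    `|g2 ((b + d)^-1 *: x) - g2 ((b + d)^-1 *: y)| <= `|x - y|.
  apply: le_trans (g2le _ _) _; rewrite -scalerBr normrZ ger0_norm ?invr_ge0 ?(ltW b0) //.
  by rewrite mulrA divff ?mul1r // gt_eqF.
have factE x : x \in k -> (quot_map L \o T \o @subspace_incl R E M) x =
    g2 ((b + d)^-1 *: ((a + d) * (b + d) *: T2 (g x))).
  move=> /X0k Xx; rewrite gE' (linear_mapZ lT2) !scalerA.
  rewrite (_ : _ * _ * _ = 1) ?scale1r; last by field; rewrite !gt_eqF.
  exact: (congr1 (fun f => f (SigSub (mem_set Xx))) gE).
have TC' : (a + d) * (b + d) * ideal_norm A T2 * 1 <= C by rewrite mulr1.
by exists (@Factorization R A _ _ _ C k G1 G2 g _ (fun y => g2 ((b + d)^-1 *: y))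
  (conj AT' (le_trans T'le TC')) g_le g_lip h_lip factE).
Qed.

End Factorizations.

Lemma lip_max_linear_ideal (R : realType) (A : banach_ideal R)
    (A_maximal : maximal A)
    (A_gateaux : forall M F : banach R, finite_dim M ->
       forall f : M -> F, @ideal_Lip R A (norm_pm M) F f ->
       exists x0 : M, gateaux_differentiable f x0)
    (E F : banach R) (T : E -> F) :
  bounded_op T -> (lip_max_norm (Lip_ideal_Lip A) (T : norm_pm E -> F) < +oo)%E ->
  ideal_ops A T /\
  ((ideal_norm A T)%:E <= lip_max_norm (Lip_ideal_Lip A) (T : norm_pm E -> F))%E.
Proof.
move=> bT; set r := lip_max_norm _ _ => roo.
have maxle : (op_max_norm (ideal_class A) T <= r)%E.
  apply: ge_ereal_sup => _ [M [fM [L [fL ->]]]].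
  have r0 : (0 <= r)%E.
    have X00 : [set pm_point (norm_pm E)] (pm_point (norm_pm E)) by [].
    apply: le_ereal_sup_tmp; eexists; first by exists _, X00, L, fL; split.
    exact: Lip_ideal_Lip_norm_ge0.
  have [C rE] : exists C : R, r = C%:E by exists (fine r); rewrite fineK // ge0_fin_numE.
  pose S : finite_dim_banach fM -> finite_dim_banach fL :=
    quot_map L \o T \o @subspace_incl R E M.
  have lS : linear S.
    move=> a x y; rewrite /S /= -(@quot_map_linear _ _ L) -bT.1.
    by congr (quot_map L (T _)).
  (* The slack [e] provides the strict inequality needed to extract factorizations. *)
  have est e : 0 < e -> ideal_ops A S /\ ideal_norm A S <= C + e.
    move=> e0; apply: local_estimate => //.
    - by move=> G f; apply: A_gateaux.
    - by rewrite addr_ge0 ?(ltW e0) // -lee_fin -rE.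
    - by move=> k; apply: factorization_of_lip_max; rewrite -/r rE lte_fin ltrDl.
  rewrite -[_ \o _]/S /= asboolT; last exact: (est 1 ltr01).1.
  by rewrite rE lee_fin; apply/ler_addgt0Pr => e /est[].
have [AE An] := A_maximal E F.
have AT : op_component (ideal_class A) T by rewrite AE; split=> //; exact: le_lt_trans roo.
split => //; move: maxle; have := An _ AT; rewrite /= asboolT //.
by move=> <-.
Qed.

Theorem corollary4p10 (R : realType) (A : banach_ideal R)
    (A_maximal : maximal A)
    (A_gateaux : forall M F : banach R, finite_dim M ->
       forall f : M -> F, @ideal_Lip R A (norm_pm M) F f ->
       exists x0 : M, gateaux_differentiable f x0) :
  same_class (linear_part (Lip_ideal_Lip A))
             (linear_part (lip_max (Lip_ideal_Lip A))) /\
  same_class (linear_part (lip_max (Lip_ideal_Lip A))) (ideal_class A).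
Proof.
pose nI (E F : banach R) (T : E -> F) :=
  lip_class_norm (Lip_ideal_Lip A) (T : norm_pm E -> F).
pose nm (E F : banach R) (T : E -> F) :=
  lip_max_norm (Lip_ideal_Lip A) (T : norm_pm E -> F).
(* The inequalities close up: the ideal norm is at most the norm in the hull, this is at most the
   factorization norm, and this is at most the ideal norm. *)
have key (E F : banach R) (T : E -> F) : bounded_op T -> (nm E F T < +oo)%E ->
    [/\ ideal_ops A T, nI E F T = (ideal_norm A T)%:E & nm E F T = (ideal_norm A T)%:E].
  move=> bT Too; have [AT h1] := lip_max_linear_ideal A_maximal A_gateaux bT Too.
  have [_ h2] := ideal_sub_Lip_ideal_Lip AT.
  have h3 := Lip_ideal_Lip_sub_max A (T : norm_pm E -> F).
  split=> //; apply/eqP; rewrite eq_le; apply/andP; split => //.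
  - exact: le_trans h1 h3.
  - exact: le_trans h3 h2.
have ideal_max (E F : banach R) (T : E -> F) : ideal_ops A T ->
    bounded_op T /\ (nm E F T < +oo)%E.
  move=> AT; split; first exact: ideal_bounded AT.
  have [_ h2] := ideal_sub_Lip_ideal_Lip AT.
  apply: le_lt_trans (ltry (ideal_norm A T)); apply: le_trans h2.
  exact: Lip_ideal_Lip_sub_max.
have bounded_Lip0 (E F : banach R) (T : E -> F) : bounded_op T ->
    @Lip0 R (norm_pm E) (norm_pm F) T.
  move=> [lT [c Tc]]; split; first exact: linear_map0.
  exists `|c|; split => // x y.
  change (`|T x - T y| <= `|c| * `|(x : E) - y|); rewrite -(linear_mapB lT).
  by apply: le_trans (Tc _) _; rewrite ler_wpM2r // ler_norm.
have I_max (E F : banach R) (T : E -> F) :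
    lip_component (Lip_ideal_Lip A) (T : norm_pm E -> F) -> (nm E F T < +oo)%E.
  move=> [G1 [G2 [g1 [T2 [g2 fac]]]]]; apply: le_lt_trans (Lip_ideal_Lip_sub_max _ _) _.
  apply: (@le_lt_trans _ _ (@Lip R _ (norm_metric G1) g1 * ideal_norm A T2 *
    @Lip R (norm_metric G2) (norm_metric F) g2)%:E); last exact: ltry.
  apply: ge_ereal_inf; eexists; last exact: lexx.
  by exists G1, G2, g1, T2, g2; split.
split=> E F; split.
- apply/seteqP; split => T [/= h bT]; split => //.
    by split; [exact: bounded_Lip0|exact: I_max].
  have [_ Too] := h; have [AT _ _] := key _ _ _ bT Too.
  by have [] := ideal_sub_Lip_ideal_Lip AT.
- move=> T [h bT]; have [_ nIE nmE] := key _ _ _ bT (I_max _ _ _ h).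
  by rewrite -[LHS]/(nI E F T) nIE -nmE.
- apply/seteqP; split => T /=; first by move=> [[_ Too] bT]; have [] := key _ _ _ bT Too.
  by move=> /ideal_max[bT Too]; split => //; split => //; exact: bounded_Lip0.
- move=> T [[_ Too] bT]; have [AT _ nmE] := key _ _ _ bT Too.
  by rewrite -[LHS]/(nm E F T) nmE /= asboolT.
Qed.
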